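(* Let $(M,g)$ be a Riemannian manifold with curvature tensor $R_{pijk}$, let $N\subset M$ be an open contractible subset, and let $\Pi_{ab}$ be a field of symmetric bilinear forms on $N$ satisfying $$R_{pijk}=\Pi_{pj}\Pi_{ik}-\Pi_{pk}\Pi_{ij}\qquad\text{and}\qquad \Pi_{a[b;c]}=0 .$$ Then for any point $p\in N$ and any initial conditions at $p$ (a value for $h$ and a covector value for $h_{;a}$) with $g^{ab}h_{;a}h_{;b}<1$ at $p$, there is a maximal open connected set $S\subset N$ with $p\in S$ on which there exists a scalar field $h$ satisfying $$\Pi_{ab}=\frac{h_{;ab}}{(1-g^{mn}h_{;m}h_{;n})^{1/2}}$$ and the initial conditions at $p$. The field $h$ is unique.
   Context: All objects are smooth. '';'' is covariant differentiation with respect to the Levi-Civita connection of $g$; repeated upper/lower indices are summed; $\Pi_{a[b;c]}=\frac12(\Pi_{ab;c}-\Pi_{ac;b})$. Curvature sign convention: the unit round sphere has $R_{pijk}=g_{pj}g_{ik}-g_{pk}g_{ij}$. For $h$ to satisfy the displayed equation for $\Pi_{ab}$ on a set is understood to include $g^{mn}h_{;m}h_{;n}<1$ on that set, so that the right-hand side is defined and real. *)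

(* Defs.v *)
From HB Require Import structures.
From mathcomp Require Import all_boot all_order all_algebra.
From mathcomp Require Import all_classical all_reals all_analysis.

Set Implicit Arguments.
Unset Strict Implicit.
Unset Printing Implicit Defensive.

Import Order.TTheory GRing.Theory Num.Theory.
Import numFieldNormedType.Exports.

Local Open Scope classical_set_scope.
Local Open Scope ring_scope.

(* A homeomorphism from an open set of M onto an open set of R^n.  The maps
   are total; their values off the domain, resp. off the image, are junk. *)
Record chart (R : realType) (n : nat) (M : topologicalType) := Chart {
  cdom : set M;
  cmap : M -> 'rV[R]_n;
  cinv : 'rV[R]_n -> M;
  cdom_open : open cdom;
  cimg_open : open (cmap @` cdom);
  cmapK : forall x, cdom x -> cinv (cmap x) = x;
  cmap_continuous : forall x, cdom x -> {for x, continuous cmap};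
  cinv_continuous : forall y, (cmap @` cdom) y -> {for y, continuous cinv} }.

Section Charts.
Context {R : realType} {n : nat} {M : topologicalType}.
Implicit Types (c : chart R n M) (f : M -> R) (U : set M).

Definition coord c (i : 'I_n) : M -> R := fun x => cmap c x 0 i.

(* Coordinate derivative of f in the chart c, again a function on M; it is
   meaningful on the domain of c, and can be iterated there. *)
Definition partial c (i : 'I_n) f : M -> R :=
  fun x => 'D_(delta_mx 0 i) (f \o cinv c) (cmap c x).

Definition has_partial c (i : 'I_n) f (x : M) : Prop :=
  derivable (f \o cinv c) (cmap c x) (delta_mx 0 i).

(* Meant for U open and contained in the domain of c. *)
Fixpoint Ck c (k : nat) U f : Prop :=
  (forall x, U x -> {for x, continuous f}) /\
  (if k is k'.+1 then
     forall i, (forall x, U x -> has_partial c i f x) /\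
               Ck c k' U (partial c i f)
   else True).

Definition smooth_in c U f : Prop := forall k, Ck c k U f.

(* The (i, j) entry is dy^j / dx^i for x = c and y = c'. *)
Definition jac c c' (x : M) : 'M[R]_n :=
  \matrix_(i, j) partial c i (coord c' j) x.

End Charts.

Record smooth_manifold (R : realType) (n : nat) := SmoothManifold {
  carrier :> topologicalType;
  atlas : set (chart R n carrier);
  carrier_hausdorff : hausdorff_space carrier;
  carrier_second_countable : @second_countable carrier;
  atlas_cover : forall x, exists2 c, atlas c & cdom c x;
  atlas_compat : forall c c', atlas c -> atlas c' ->
    forall j, smooth_in c (cdom c `&` cdom c') (coord c' j) }.

Section Tensors.
Context {R : realType} {n : nat} {M : smooth_manifold R n}.
Implicit Types (c : chart R n M) (x : M) (U : set M).

Definition smooth_on U (f : M -> R) : Prop :=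
  forall c, atlas c -> smooth_in c (U `&` cdom c) f.

(* Covectors at a point and covariant 2-tensor fields are given by their
   components in each chart, subject to the transformation law. *)
Definition covector_at (x : M) (w : chart R n M -> 'rV[R]_n) : Prop :=
  forall c c', atlas c -> atlas c' -> cdom c x -> cdom c' x ->
    w c = w c' *m (jac c c' x)^T.

Definition tensor2_on U (T : chart R n M -> M -> 'M[R]_n) : Prop :=
  (forall c c' x, atlas c -> atlas c' -> U x -> cdom c x -> cdom c' x ->
     T c x = jac c c' x *m T c' x *m (jac c c' x)^T) /\
  (forall c a b, atlas c -> smooth_in c (U `&` cdom c) (fun x => T c x a b)).

Definition symmetric_on U (T : chart R n M -> M -> 'M[R]_n) : Prop :=
  forall c x, atlas c -> U x -> cdom c x -> (T c x)^T = T c x.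

Definition riemannian_metric (g : chart R n M -> M -> 'M[R]_n) : Prop :=
  [/\ tensor2_on setT g, symmetric_on setT g &
    forall c x (v : 'rV[R]_n), atlas c -> cdom c x -> v != 0 ->
      0 < (v *m g c x *m v^T) 0 0].

(* P holds at every point of U, in every chart around that point. *)
Definition in_charts U (P : chart R n M -> M -> Prop) : Prop :=
  forall c x, atlas c -> U x -> cdom c x -> P c x.

Variable g : chart R n M -> M -> 'M[R]_n.

(* g^{ab} *)
Definition ginv c x (a b : 'I_n) : R := invmx (g c x) a b.

(* Gamma^d_{ab} of the Levi-Civita connection *)
Definition christoffel c (d a b : 'I_n) : M -> R := fun x =>
  2^-1 * \sum_e ginv c x d e *
    (partial c a (fun y => g c y e b) x + partial c b (fun y => g c y e a) x
     - partial c e (fun y => g c y a b) x).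

(* R^q_{ijk} = d_j Gamma^q_{ik} - d_k Gamma^q_{ij}
               + Gamma^q_{mj} Gamma^m_{ik} - Gamma^q_{mk} Gamma^m_{ij};
   with this sign R_{pijk} = g_{pj} g_{ik} - g_{pk} g_{ij} on the unit
   sphere. *)
Definition curvature_up c x (q i j k : 'I_n) : R :=
  partial c j (christoffel c q i k) x - partial c k (christoffel c q i j) x
  + \sum_m (christoffel c q m j x * christoffel c m i k x
            - christoffel c q m k x * christoffel c m i j x).

Definition curvature c x (p i j k : 'I_n) : R :=
  \sum_q g c x p q * curvature_up c x q i j k.

(* T_{ab;e} *)
Definition cov_deriv2 (T : chart R n M -> M -> 'M[R]_n) c x
    (a b e : 'I_n) : R :=
  partial c e (fun y => T c y a b) x
  - \sum_d christoffel c d a e x * T c x d b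
  - \sum_d christoffel c d b e x * T c x a d.

(* h_{;ab} *)
Definition hessian (h : M -> R) c x (a b : 'I_n) : R :=
  partial c b (partial c a h) x
  - \sum_d christoffel c d a b x * partial c d h x.

(* g^{ab} w_a w_b, for w the components of a covector at x in the chart c *)
Definition conorm2 c x (w : 'rV[R]_n) : R :=
  \sum_a \sum_b ginv c x a b * w 0 a * w 0 b.

(* h_{;a} *)
Definition dscalar (h : M -> R) c x : 'rV[R]_n := \row_a partial c a h x.

Variable Pi : chart R n M -> M -> 'M[R]_n.

Definition gauss_on U : Prop := in_charts U (fun c x => forall p i j k,
  curvature c x p i j k = Pi c x p j * Pi c x i k - Pi c x p k * Pi c x i j).

(* Pi_{a[b;c]} = 0 *)
Definition codazzi_on U : Prop := in_charts U (fun c x => forall a b e,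
  2^-1 * (cov_deriv2 Pi c x a b e - cov_deriv2 Pi c x a e b) = 0).

Definition solves_on U (h : M -> R) : Prop :=
  smooth_on U h /\
  in_charts U (fun c x => conorm2 c x (dscalar h c x) < 1 /\
    forall a b, Pi c x a b =
      hessian h c x a b / Num.sqrt (1 - conorm2 c x (dscalar h c x))).

Definition initial_at (p : M) (h0 : R) (w : chart R n M -> 'rV[R]_n)
    (h : M -> R) : Prop :=
  h p = h0 /\ forall c, atlas c -> cdom c p -> dscalar h c p = w c.

Definition admissible (N : set M) p h0 w (S : set M) : Prop :=
  [/\ open S, connected S, S `<=` N, S p &
    exists h, solves_on S h /\ initial_at p h0 w h].

End Tensors.

(* N is nonempty and its identity map is homotopic, within N, to a constant. *)
Definition contractible (R : realType) (M : topologicalType) (N : set M) :=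
  exists (x0 : M) (H : R * M -> M),
    [/\ N x0,
        forall (t : R) x, t \in `[0, 1]%R -> N x -> N (H (t, x)),
        {within `[0, 1]%classic `*` N, continuous H},
        forall x, N x -> H (0, x) = x &
        forall x, N x -> H (1, x) = x0].

(* S is a maximal element, for inclusion, of the family P. *)
Definition maximal_set (T : Type) (P : set T -> Prop) (S : set T) : Prop :=
  P S /\ forall S', P S' -> S `<=` S' -> S' = S.

(* Main.v *)
From HB Require Import structures.
From mathcomp Require Import all_boot all_order all_algebra.
From mathcomp Require Import all_classical all_reals all_analysis.
From mathcomp Require Import ring lra.
Require Import Defs.
Import Order.TTheory GRing.Theory Num.Theory.
Import numFieldNormedType.Exports.
Local Open Scope classical_set_scope.
Local Open Scope ring_scope.

Set Implicit Arguments.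
Unset Strict Implicit.
Unset Printing Implicit Defensive.

(** The equation for [h] becomes linear when the unknowns are
    [w_a = h_{;a}] and [k = (1 - g^{mn} w_m w_n)^{1/2}] together with [h]:
<<
      h_{;a} = w_a      w_{a;b} = k Pi_ab      k_{;b} = - Pi_b^m w_m
>>
    Geometrically [N] is locally a hypersurface of a Euclidean space with
    second fundamental form [Pi], and [h, w, k] are the height along a fixed
    unit vector and the tangential and normal parts of that vector.
    Conversely [|w|^2 + k^2] is constant along every solution of the linear
    system, so a solution which starts with [|w|^2 + k^2 = 1] and [k > 0]
    solves the original equation as long as [k] stays positive.

    In a chart the system reads [d_b y = A_b y], and the equality of the mixed
    second derivatives of [y] is exactly the Gauss and Codazzi equations
    ([jet_matrix_flat]).  A flat linear system has a solution near every point
    for every initial value ([frobenius_chart]): it is obtained by solving a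
    linear ordinary differential equation along each ray from the centre, and
    flatness bounds the difference of the solutions along two neighbouring
    rays to second order, which gives the partial derivatives without any
    theory of dependence on parameters ([frobenius_bounded]).  Hence
    [local_solution], once a solution built in one chart is known to satisfy
    the equation in all charts.  That is the tensor law of the Hessian
    ([hessian_change]), which rests on the uniqueness of the Levi-Civita
    symbols ([koszul_unique]) and on the symmetry of second derivatives
    ([schwarz]).

    On a segment, a solution of the linear system which vanishes at one end
    vanishes identically, so two solutions of the original equation with the
    same value and differential at a point coincide nearby ([local_unique]).
    The points near which two solutions coincide therefore form an open and
    closed subset of a connected domain ([solution_unique]).  Uniqueness lets
    the solutions on a chain of admissible sets be glued on their union, and
    Zorn's lemma gives a maximal set ([maximal_admissible]). *)

(** * One-variable calculus and directional derivatives *)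

Section Calculus1.
Context {R : realType}.

Lemma is_derive_ext {V W : normedModType R} (f g : V -> W) (x v : V) (d e : W) :
  f =1 g -> d = e -> is_derive x v f d -> is_derive x v g e.
Proof. by move=> /funext -> ->. Qed.

Lemma is_derive_cont {W : normedModType R} (f : R -> W) (x : R) (d : W) :
  is_derive x 1 f d -> {for x, continuous f}.
Proof. by case=> h _; exact/differentiable_continuous/derivable1_diffP. Qed.

Lemma is_derive_within (f df : R -> R) (a b : R) :
  (forall t, a <= t <= b -> is_derive t 1 f (df t)) ->
  {within `[a, b], continuous f}.
Proof.
move=> h; apply: derivable_within_continuous => t; rewrite in_itv /= => tab.
by have [] := h t tab.
Qed.

Lemma mean_value (f df : R -> R) (a b : R) : a <= b ->
  (forall t, a <= t <= b -> is_derive t 1 f (df t)) ->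
  exists2 c, a <= c <= b & f b - f a = df c * (b - a).
Proof.
move=> ab h; have [] := @MVT_segment R f df a b ab.
- by move=> x; rewrite in_itv /= => /andP[xa xb]; apply: h; rewrite !ltW.
- exact: is_derive_within h.
by move=> c; rewrite in_itv /=; exists c.
Qed.

Lemma mean_value_le (f df : R -> R) (C a b : R) : a <= b ->
  (forall t, a <= t <= b -> is_derive t 1 f (df t)) ->
  (forall t, a <= t <= b -> `|df t| <= C) ->
  `|f b - f a| <= C * (b - a).
Proof.
move=> ab h hC; have [c cab ->] := mean_value ab h.
by rewrite normrM [`|b - a|]ger0_norm ?subr_ge0// ler_wpM2r ?subr_ge0// hC.
Qed.

(** A directional derivative is the derivative at 0 of a function of one
    variable, so the one-variable chain rule applies in every direction. *)
Lemma is_derive_line {V W : normedModType R} (f : V -> W) (x v : V) (d : W) :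
  is_derive x v f d <->
  is_derive (0 : R) (1 : R) (fun s : R => f (s *: v + x)) d.
Proof.
have E : 'D_(1 : R) (fun s : R => f (s *: v + x)) 0 = 'D_v f x.
  rewrite /derive; set g1 := fun h => _; set g2 := (X in _ = lim (X @ _)).
  suff -> : g1 = g2 by [].
  by apply/funext => s; rewrite /g1 /g2 /= addr0 scale0r add0r [_%:A]mulr1.
split=> -[h <-]; split; rewrite ?E//.
  exact: (derivable1P f x v).1.
exact: (derivable1P f x v).2.
Qed.

Lemma is_derive_shift (W : normedModType R) (f : R -> W) (a t : R) (d : W) :
  is_derive (a + t) 1 f d <-> is_derive t 1 (fun s => f (a + s)) d.
Proof.
have E : (fun s : R => f (s *: 1 + (a + t))) = (fun s => f (a + (s *: 1 + t))).
  by apply/funext => s; rewrite addrCA.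
by split=> /is_derive_line h; apply/is_derive_line; rewrite /= ?E// -E.
Qed.

Lemma is_derive_add {V : normedModType R} (f g : V -> R) x v df dg :
  is_derive x v f df -> is_derive x v g dg ->
  is_derive x v (fun y => f y + g y) (df + dg).
Proof. exact: is_deriveD. Qed.

Lemma is_derive_sub {V : normedModType R} (f g : V -> R) x v df dg :
  is_derive x v f df -> is_derive x v g dg ->
  is_derive x v (fun y => f y - g y) (df - dg).
Proof. exact: is_deriveB. Qed.

Lemma is_derive_mul {V : normedModType R} (f g : V -> R) x v df dg :
  is_derive x v f df -> is_derive x v g dg ->
  is_derive x v (fun y => f y * g y) (df * g x + f x * dg).
Proof.
move=> hf hg; apply: (is_derive_ext _ _ (is_deriveM hf hg)) => //.
by rewrite addrC; congr (_ + _); rewrite [_ *: _]mulrC.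
Qed.

Lemma is_derive_bigsum {V : normedModType R} (I : Type) (r : seq I) (f : I -> V -> R) x v df :
  (forall i, is_derive x v (f i) (df i)) ->
  is_derive x v (fun y => \sum_(i <- r) f i y) (\sum_(i <- r) df i).
Proof.
move=> h; elim: r => [|i r IH].
  apply: (is_derive_ext _ _ (is_derive_cst 0 x v)); last by rewrite big_nil.
  by move=> y; rewrite big_nil.
apply: (is_derive_ext _ _ (is_derive_add (h i) IH)); last by rewrite big_cons.
by move=> y; rewrite big_cons.
Qed.

Lemma is_derive_curve {V W : normedModType R} (phi : R -> V) (f : V -> W) (t : R) (dphi : V) :
  is_derive t 1 phi dphi -> differentiable f (phi t) ->
  is_derive t 1 (fun s => f (phi s)) ('D_dphi f (phi t)).
Proof.
move=> [h <-] df; have dphi' := (derivable1_diffP _ _).1 h.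
have hc : differentiable (f \o phi) t by exact: differentiable_comp.
split; first exact/derivable1_diffP.
by rewrite -[fun s => _]/(f \o phi) !deriveE// diff_comp.
Qed.

Lemma near_forall {T : topologicalType} {I : finType} (x : T) (P : I -> T -> Prop) :
  (forall i, \forall y \near x, P i y) -> \forall y \near x, forall i, P i y.
Proof. by move=> h; exact: (@filter_forall _ _ P (nbhs x) _ h). Qed.

Lemma near_and {T : topologicalType} (x : T) (P Q : T -> Prop) :
  (\forall y \near x, P y) -> (\forall y \near x, Q y) ->
  \forall y \near x, P y /\ Q y.
Proof. exact: filterI. Qed.

Lemma differentiable_of_approx {V W : normedModType R} (f : V -> W) (L : {linear V -> W}) x :
  continuous L ->
  (forall e : R, 0 < e -> \forall h \near 0, `|f (h + x) - f x - L h| <= e * `|h|) ->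
  differentiable f x.
Proof.
move=> Lc h.
have Lf : f \o shift x = cst (f x) + L +o_ 0 id.
  apply/eqaddoP => e e0; near=> u.
  by rewrite /= !fctE opprD addrA; near: u; exact: h.
by apply/diff_locallyP; rewrite (diff_unique Lc Lf); split.
Unshelve. all: by end_near. Qed.

Lemma is_derive_row {n} (phi : R -> 'rV[R]_n) (t : R) (d : 'rV[R]_n) :
  (forall j, is_derive t 1 (fun s => phi s 0 j) (d 0 j)) -> is_derive t 1 phi d.
Proof.
move=> h; have hp : derivable phi t 1.
  by apply/derivable_mxP => i j; rewrite ord1; have [] := h j.
split=> //; rewrite derive_mx//; apply/rowP => j.
by rewrite mxE; have [_ <-] := h j.
Qed.

Lemma cont_add {T : topologicalType} (f g : T -> R) x :
  {for x, continuous f} -> {for x, continuous g} ->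
  {for x, continuous (fun y => f y + g y)}.
Proof. by move=> hf hg; apply: (continuousD hf hg). Qed.

Lemma cont_opp {T : topologicalType} (f : T -> R) x :
  {for x, continuous f} -> {for x, continuous (fun y => - f y)}.
Proof. by move=> hf; apply: (continuousN hf). Qed.

Lemma cont_mul {T : topologicalType} (f g : T -> R) x :
  {for x, continuous f} -> {for x, continuous g} ->
  {for x, continuous (fun y => f y * g y)}.
Proof. by move=> hf hg; apply: (continuousM hf hg). Qed.

Lemma cont_sum {T : topologicalType} (I : Type) (r : seq I) (f : I -> T -> R) x :
  (forall i, {for x, continuous (f i)}) ->
  {for x, continuous (fun y => \sum_(i <- r) f i y)}.
Proof.
move=> h; elim: r => [|i r IH].
  have -> : (fun y => \sum_(i <- [::]) f i y) = cst 0.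
    by apply/funext => y; rewrite big_nil.
  exact: cst_continuous.
have -> : (fun y => \sum_(j <- i :: r) f j y) = fun y => f i y + \sum_(j <- r) f j y.
  by apply/funext => y; rewrite big_cons.
exact: cont_add.
Qed.

End Calculus1.

(** * Continuous partial derivatives and differentiability *)

Section RowCalculus.
Context {R : realType} {n : nat}.
Implicit Types (f : 'rV[R]_n -> R) (x y v : 'rV[R]_n).
Local Notation e_ i := (delta_mx 0 i : 'rV[R]_n).

Lemma row_coord_le v j : `|v 0 j| <= `|v|.
Proof. by rewrite [leRHS]/Num.Def.normr /= mx_normrE (le_bigmax _ _ (0, j)). Qed.

Lemma row_norm_le v (C : R) : 0 <= C -> (forall j, `|v 0 j| <= C) -> `|v| <= C.
Proof.
move=> C0 h; rewrite [leLHS]/Num.Def.normr /= mx_normrE bigmax_le// => -[i j] _.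
by rewrite ord1 h.
Qed.

Lemma norm_delta_le (i : 'I_n) : `|e_ i| <= 1.
Proof. by apply: row_norm_le => // j; rewrite !mxE; case: (_ && _); rewrite ?normr1 ?normr0. Qed.

Lemma ball_rowE x (r : R) y : ball x r y <-> `|y - x| < r.
Proof. by rewrite -ball_normE /ball_/= distrC. Qed.

Lemma near_rowP x (P : 'rV[R]_n -> Prop) :
  (\forall y \near x, P y) <->
  exists2 r : R, 0 < r & forall y, `|y - x| < r -> P y.
Proof.
split=> [/nbhs_ballP[r r0 hr]|[r r0 hr]].
  by exists r => // y /ball_rowE /hr.
by apply/nbhs_ballP; exists r => // y /ball_rowE /hr.
Qed.

Lemma is_derive_along f y v (s d : R) :
  is_derive (s *: v + y) v f d <->
  is_derive s 1 (fun s : R => f (s *: v + y)) d.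
Proof.
rewrite is_derive_line.
suff -> : (fun s0 : R => f (s0 *: v + (s *: v + y))) =
          (fun s0 => (fun s => f (s *: v + y)) (s + s0)).
  have := is_derive_shift (fun s : R => f (s *: v + y)) s 0 d.
  by rewrite addr0 => ->.
by apply/funext => t; rewrite scalerDl addrCA -addrA addrCA.
Qed.

(** Consecutive truncations of [h] differ along one axis only: they are the
    corners of a staircase from [0] to [h]. *)
Definition rowhead (h : 'rV[R]_n) (k : nat) : 'rV[R]_n :=
  \row_j (if (j < k)%N then h 0 j else 0).

(** Every step of the staircase from [x] to [h + x] is parallel to an axis,
    so the mean value theorem bounds it through a single partial derivative.
    In the maximum norm the staircase stays in the ball of radius [`|h|]
    around [x]. *)
Lemma row_increment_le f x (r e : R) (D : 'I_n -> R) :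
  (forall y i, `|y - x| < r -> derivable f y (e_ i)) ->
  (forall y i, `|y - x| < r -> `|'D_(e_ i) f y - D i| <= e) ->
  0 <= e ->
  forall h, `|h| < r ->
  `|f (h + x) - f x - \sum_i h 0 i * D i| <= n%:R * (e * `|h|).
Proof.
move=> hd he e0 h hr.
have hk k : `|rowhead h k| <= `|h|.
  by apply: row_norm_le => // j; rewrite mxE; case: ifP => _; rewrite ?normr0// row_coord_le.
have h0 : rowhead h 0 = 0 by apply/rowP => j; rewrite !mxE.
have hn : rowhead h n = h by apply/rowP => j; rewrite !mxE ltn_ord.
have tel : f (h + x) - f x =
    \sum_(i < n) (f (rowhead h i.+1 + x) - f (rowhead h i + x)).
  by rewrite -(big_mkord xpredT (fun k => f (rowhead h k.+1 + x) - f (rowhead h k + x)))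
    telescope_sumr// h0 hn add0r.
rewrite tel -sumrB; apply: le_trans (ler_norm_sum _ _ _) _.
rewrite mulr_natl -[X in _ *+ X]card_ord -sumr_const; apply: ler_sum => i _.
pose phi t : 'rV[R]_n := t *: e_ i + (rowhead h i + x).
have step : rowhead h i.+1 + x = phi (h 0 i).
  apply/rowP => j; rewrite !mxE ltnS leq_eqVlt eqxx /= addrA; congr (_ + _).
  rewrite -val_eqE /=; case: ltngtP => //= ji; rewrite ?mulr0 ?mulr1 ?add0r ?addr0//.
  by congr (h 0 _); apply/val_inj.
have step0 : rowhead h i + x = phi 0 by rewrite /phi scale0r add0r.
have phib t : `|t| <= `|h 0 i| -> `|phi t - x| < r.
  move=> th; apply: le_lt_trans hr; rewrite /phi addrA addrK.
  apply: row_norm_le => // j; rewrite !mxE eqxx /=.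
  case: eqVneq => [->|ji]; rewrite ?ltnn /= ?mulr0 ?mulr1 ?add0r ?addr0.
    by rewrite (le_trans th)// row_coord_le.
  by case: ifP; rewrite ?normr0 ?row_coord_le.
(* subtracting the linear term turns the estimate into a bound on a derivative *)
pose g t : R := f (phi t) - t * D i.
have gd (t : R) : `|t| <= `|h 0 i| -> is_derive t 1 g ('D_(e_ i) f (phi t) - D i).
  move=> th; apply: is_derive_sub.
    by apply/is_derive_along; apply: derivableP; apply: hd; exact: phib.
  have := is_derive_mul (is_derive_id t (1:R)) (is_derive_cst (D i) t (1:R)).
  by rewrite mul1r mulr0 addr0.
have -> : f (rowhead h i.+1 + x) - f (rowhead h i + x) - h 0 i * D i = g (h 0 i) - g 0.
  by rewrite /g step step0 mul0r subr0 addrAC.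
have H : `|g (h 0 i) - g 0| <= e * `|h 0 i|.
  have [h0i|/ltW h0i] := leP 0 (h 0 i).
    have E : `|h 0 i| = h 0 i - 0 by rewrite subr0 ger0_norm.
    rewrite [in leRHS]E; apply: mean_value_le => //.
      move=> t /andP[t0 t1]; apply: gd; rewrite !ger0_norm//.
    move=> t /andP[t0 t1]; apply: he; apply: phib; rewrite !ger0_norm//.
  have E : `|h 0 i| = 0 - h 0 i by rewrite sub0r ler0_norm.
  rewrite distrC [in leRHS]E; apply: mean_value_le => //.
    move=> t /andP[t0 t1]; apply: gd; rewrite !ler0_norm// lerN2//.
  move=> t /andP[t0 t1]; apply: he; apply: phib; rewrite !ler0_norm// lerN2//.
by rewrite (le_trans H)// ler_wpM2l// row_coord_le.
Qed.

(** Near [x] the partial derivatives are within a small multiple of [e] of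
    their values at [x], and [row_increment_le] sums the errors. *)
Lemma C1_differentiable f x :
  (\forall y \near x, forall i, derivable f y (e_ i)) ->
  (forall i, {for x, continuous ('D_(e_ i) f)}) ->
  differentiable f x.
Proof.
move=> hd hc.
pose L v : R := \sum_i v 0 i * 'D_(e_ i) f x.
have lin : linear L.
  move=> a u v; rewrite /L scaler_sumr -big_split; apply: eq_bigr => i _ /=.
  by rewrite !mxE mulrDl -mulrA.
pose LM := GRing.isLinear.Build _ _ _ _ _ lin.
pose LL : {linear 'rV[R]_n -> R} := HB.pack L LM.
have Lc : continuous L.
  move=> v; apply: cont_sum => i; apply: cont_mul.
    exact: coord_continuous.
  exact: cst_continuous.
apply: (@differentiable_of_approx _ _ _ f LL x Lc) => e e0.
(* [n.+1] rather than [n], which may be 0 *)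
have e1 : 0 < e / n.+1%:R :> R by rewrite divr_gt0.
have h3 : \forall y \near x,
    forall i, `|'D_(e_ i) f x - 'D_(e_ i) f y| <= e / n.+1%:R.
  by apply: near_forall => i; have /cvgrPdist_le := hc i; apply.
have /near_rowP[r r0 hr] := near_and hd h3.
near=> h.
apply: le_trans (@row_increment_le f x r (e / n.+1%:R) (fun i => 'D_(e_ i) f x) _ _ _ h _) _.
- by move=> y i yr; have [] := hr y yr.
- by move=> y i yr; rewrite distrC; have [] := hr y yr.
- exact: ltW.
- by near: h; apply/near_rowP; exists r => // y; rewrite subr0.
rewrite mulrA ler_wpM2r// mulrCA ler_piMr ?ltW//.
by rewrite ltr_pdivrMr// mul1r ltr_nat.
Unshelve. all: by end_near. Qed.

End RowCalculus.

(** * Symmetry of second derivatives *)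

Section Schwarz.
Context {R : realType} {n : nat}.
Implicit Types (f : 'rV[R]_n -> R) (x y v : 'rV[R]_n).
Local Notation e_ i := (delta_mx 0 i : 'rV[R]_n).

(** The mean value theorem along [e_ i], applied to the increment of [f] along
    [e_ j], and then along [e_ j]. *)
Lemma second_difference f x (i j : 'I_n) (r s : R) : 0 < s -> 2 * s < r ->
  (forall y, `|y - x| < r -> derivable f y (e_ i)) ->
  (forall y, `|y - x| < r -> derivable ('D_(e_ i) f) y (e_ j)) ->
  exists2 y, `|y - x| < r &
    f (s *: e_ i + s *: e_ j + x) - f (s *: e_ i + x)
      - (f (s *: e_ j + x) - f x)
    = s ^+ 2 * 'D_(e_ j) ('D_(e_ i) f) y.
Proof.
move=> s0 sr di dj.
have inb (t u : R) : 0 <= t <= s -> 0 <= u <= s ->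
    `|t *: e_ i + (u *: e_ j + x) - x| < r.
  move=> /andP[t0 ts] /andP[u0 us]; rewrite addrA addrK; apply: le_lt_trans sr.
  rewrite (le_trans (ler_normD _ _))// !normrZ !ger0_norm// mulr_natl mulr2n.
  by rewrite lerD// (le_trans (ler_piMr _ (norm_delta_le _))).
have [ss0 s00] : 0 <= s <= s /\ (0 : R) <= 0 <= s by rewrite !lexx ltW.
pose g (t : R) := f (t *: e_ i + (s *: e_ j + x)) - f (t *: e_ i + (0 *: e_ j + x)).
pose dg (t : R) := 'D_(e_ i) f (t *: e_ i + (s *: e_ j + x))
   - 'D_(e_ i) f (t *: e_ i + (0 *: e_ j + x)).
have [t ts gE] : exists2 c, 0 <= c <= s & g s - g 0 = dg c * (s - 0).
  apply: mean_value; first exact: ltW.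
  move=> t ts; apply: is_derive_sub; apply/is_derive_along; apply: derivableP;
    apply: di; exact: inb.
pose k (u : R) := 'D_(e_ i) f (u *: e_ j + (t *: e_ i + x)).
have [u us kE] : exists2 c, 0 <= c <= s & k s - k 0 =
    'D_(e_ j) ('D_(e_ i) f) (c *: e_ j + (t *: e_ i + x)) * (s - 0).
  apply: (@mean_value _ k (fun c => 'D_(e_ j) ('D_(e_ i) f) (c *: e_ j + (t *: e_ i + x)))).
    exact: ltW.
  move=> u us; apply: (is_derive_along ('D_(e_ i) f) (t *: e_ i + x) (e_ j) u _).1.
  apply: derivableP; apply: dj.
  by rewrite addrCA inb.
exists (t *: e_ i + (u *: e_ j + x)); first exact: inb.
have -> : f (s *: e_ i + s *: e_ j + x) - f (s *: e_ i + x)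
      - (f (s *: e_ j + x) - f x) = g s - g 0.
  by rewrite /g !scale0r !add0r addrA.
rewrite gE; have -> : dg t = k s - k 0 by rewrite /dg /k !(addrCA (t *: _)).
by rewrite kE subr0 [u *: _ + _]addrCA; ring.
Qed.

Lemma dist_half (a b c e : R) :
  `|c - a| <= e / 2 -> `|b - a| <= e / 2 -> `|c - b| <= e.
Proof.
move=> ca ba; have -> : c - b = (c - a) - (b - a) by ring.
by rewrite (le_trans (ler_normB _ _))// [e]splitr lerD.
Qed.

(** The second difference of [f] is symmetric in [i] and [j]; divided by
    [s ^+ 2] it is a value near [x] of either mixed derivative. *)
Lemma schwarz f x (i j : 'I_n) :
  (\forall y \near x, forall k, derivable f y (e_ k)) ->
  (\forall y \near x, forall k l, derivable ('D_(e_ k) f) y (e_ l)) ->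
  (forall k l, {for x, continuous ('D_(e_ l) ('D_(e_ k) f))}) ->
  'D_(e_ j) ('D_(e_ i) f) x = 'D_(e_ i) ('D_(e_ j) f) x.
Proof.
move=> h1 h2 hc; apply/eqP; rewrite -subr_eq0 -normr_le0; apply/ler_addgt0Pl => e e0.
have e2 : 0 < e / 2 by rewrite divr_gt0.
have ci : \forall y \near x, `|'D_(e_ j) ('D_(e_ i) f) x - 'D_(e_ j) ('D_(e_ i) f) y| <= e / 2.
  by have /cvgrPdist_le := hc i j; apply.
have cj : \forall y \near x, `|'D_(e_ i) ('D_(e_ j) f) x - 'D_(e_ i) ('D_(e_ j) f) y| <= e / 2.
  by have /cvgrPdist_le := hc j i; apply.
have /near_rowP[r r0 hr] := near_and (near_and h1 h2) (near_and ci cj).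
have s0 : 0 < r / 3 by rewrite divr_gt0.
have sr : 2 * (r / 3) < r by lra.
have [||y yr E1] := @second_difference f x i j r (r / 3) s0 sr.
- by move=> y /hr[[]].
- by move=> y /hr[[]].
have [||z zr E2] := @second_difference f x j i r (r / 3) s0 sr.
- by move=> z /hr[[]].
- by move=> z /hr[[]].
have E : 'D_(e_ j) ('D_(e_ i) f) y = 'D_(e_ i) ('D_(e_ j) f) z.
  have s2 : (r / 3) ^+ 2 != 0 by rewrite expf_neq0// gt_eqF.
  (* the two second differences differ by the order of the middle terms *)
  have swap (A B C D : R) : A - B - (C - D) = A - C - (B - D) by ring.
  by apply: (mulfI s2); rewrite -[LHS]E1 -[RHS]E2 swap (addrC ((r / 3) *: e_ i)).
have [_ [hy _]] := hr y yr; have [_ [_ hz]] := hr z zr.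
by rewrite addr0; apply: dist_half hz; rewrite -E.
Qed.

End Schwarz.

(** * Linear differential equations on the unit interval *)

Section LinearODE.
Context {R : realType}.

(** The sequence [a k - C / 2 ^+ k] increases, [a k + C / 2 ^+ k] decreases,
    and the first stays below the second: the limit is the supremum of the
    former. *)
Lemma geometric_limit (a : nat -> R) (C : R) : 0 <= C ->
  (forall k, `|a k.+1 - a k| <= C / 2 ^+ k.+1) ->
  exists l, forall k, `|l - a k| <= C / 2 ^+ k.
Proof.
move=> C0 ha.
have p2 k : (0 : R) < 2 ^+ k by rewrite exprn_gt0.
have half k : C / 2 ^+ k = C / 2 ^+ k.+1 + C / 2 ^+ k.+1.
  rewrite exprS; field; exact: lt0r_neq0.
have lo : {homo (fun k => a k - C / 2 ^+ k) : i j / (i <= j)%N >-> i <= j}.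
  apply/nondecreasing_seqP => k; have := ha k; rewrite ler_norml => /andP[].
  by rewrite (half k); lra.
have up : {homo (fun k => a k + C / 2 ^+ k) : i j / (i <= j)%N >-> j <= i}.
  apply/nonincreasing_seqP => k; have := ha k; rewrite ler_norml => /andP[].
  by rewrite (half k); lra.
have sep i j : a i - C / 2 ^+ i <= a j + C / 2 ^+ j.
  apply: le_trans (lo _ _ (leq_maxl i j)) _; apply: le_trans (up _ _ (leq_maxr i j)).
  by rewrite lerD2l -subr_ge0 opprK addr_ge0// divr_ge0// ltW.
pose E := range (fun k => a k - C / 2 ^+ k).
have E0 : E !=set0 by exists (a 0%N - C / 2 ^+ 0); exists 0%N.
exists (sup E) => k; rewrite ler_norml; apply/andP; split.
  rewrite -subr_ge0 opprK addrAC subr_ge0 -lerBlDr; apply: ub_le_sup; last by exists k.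
  by exists (a 0%N + C / 2 ^+ 0) => _ [i _ <-]; exact: sep.
rewrite lerBlDl; apply: ge_sup => // _ [i _ <-]; exact: sep.
Qed.

(** Composing with [clamp] extends a function constantly outside the unit
    interval, so that continuity can be asked on the whole line. *)
Definition clamp (t : R) : R := Num.max 0 (Num.min t 1).

Lemma clamp_ge0 t : 0 <= clamp t.
Proof. by rewrite /clamp le_max lexx. Qed.

Lemma clamp_le1 t : clamp t <= 1.
Proof. by rewrite /clamp ge_max ler01 ge_min lexx orbT. Qed.

Lemma clamp_id t : 0 <= t <= 1 -> clamp t = t.
Proof. by move=> /andP[t0 t1]; rewrite /clamp min_l// max_r. Qed.

Lemma clamp_continuous : continuous clamp.
Proof.
move=> t; apply: (@continuous_max R R (cst 0) (fun t => Num.min t 1) t).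
  exact: cst_continuous.
apply: (@continuous_min R R id (cst 1) t); [exact: cvg_id|exact: cst_continuous].
Qed.

(** The integral starts at [-1], and not at [0], to have a two-sided derivative
    at the endpoint [0] of the unit interval. *)
Definition primitive (f : R -> R) (t : R) : R :=
  (\int[lebesgue_measure]_(s in `[-1, t]) f s)%R
  - (\int[lebesgue_measure]_(s in `[-1, 0%R]) f s)%R.

Lemma primitive0 f : primitive f 0 = 0.
Proof. by rewrite /primitive subrr. Qed.

Lemma is_derive_primitive (f : R -> R) (t : R) : continuous f -> 0 <= t <= 1 ->
  is_derive t 1 (primitive f) (f t).
Proof.
move=> fc /andP[t0 t1].
have t2 : t < 2 by apply: le_lt_trans t1 _; lra.
have tm : -1 < t by apply: lt_le_trans t0; lra.
have int : lebesgue_measure.-integrable `[-1, 2] (EFin \o f).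
  apply: continuous_compact_integrable; first exact: segment_compact.
  exact: continuous_subspaceT.
have [d1 d2] := continuous_FTC1_closed t2 int tm (fc t).
have : is_derive t 1 (fun x : R => (\int[lebesgue_measure]_(s in `[-1, x]) f s)%R) (f t).
  by split; [exact: d1|rewrite -derive1E; exact: d2].
move=> h; have := is_derive_sub h (is_derive_cst _ t (1:R)).
by rewrite subr0; apply.
Qed.

(** The Picard operator of [u' = B u], [u 0 = y0], with its values extended
    constantly outside the unit interval. *)
Definition picard (I : finType) (B : I -> I -> R -> R) (y0 : I -> R)
    (u : I -> R -> R) : I -> R -> R :=
  fun i t => y0 i + primitive (fun s => \sum_j B i j s * u j s) (clamp t).

Lemma picard_continuous (I : finType) (B : I -> I -> R -> R) y0 u :
  (forall i j, continuous (B i j)) -> (forall i, continuous (u i)) ->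
  forall i, continuous (picard B y0 u i).
Proof.
move=> Bc uc i t; pose f s := \sum_j B i j s * u j s.
apply: (@cont_add R R (fun=> y0 i) (fun t => primitive f (clamp t))).
  exact: cst_continuous.
apply: (@continuous_comp R R R clamp (primitive f)); first exact: clamp_continuous.
apply: is_derive_cont; apply: is_derive_primitive; last by rewrite clamp_ge0 clamp_le1.
by move=> s; apply: cont_sum => j; apply: cont_mul; [exact: Bc|exact: uc].
Qed.

Lemma sum_small (I : finType) (b u : I -> R) (beta K : R) :
  #|I|%:R * beta <= 2^-1 -> 0 <= K ->
  (forall j, `|b j| <= beta) -> (forall j, `|u j| <= K) ->
  `|\sum_j b j * u j| <= K / 2.
Proof.
move=> hb K0 hB hu; apply: le_trans (ler_norm_sum _ _ _) _.
apply: (@le_trans _ _ (\sum_(j : I) beta * K)).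
  by apply: ler_sum => j _; rewrite normrM ler_pM.
by rewrite sumr_const -[leLHS]mulr_natl mulrA mulrC ler_wpM2l.
Qed.

(** The difference of the two primitives vanishes at 0 and has a derivative of
    size at most [K / 2], because the coefficients are small. *)
Lemma picard_contracts (I : finType) (B : I -> I -> R -> R) y0 u v (beta K : R) :
  (forall i j, continuous (B i j)) ->
  (forall i j t, 0 <= t <= 1 -> `|B i j t| <= beta) -> #|I|%:R * beta <= 2^-1 ->
  (forall i, continuous (u i)) -> (forall i, continuous (v i)) ->
  0 <= K -> (forall i t, `|u i t - v i t| <= K) ->
  forall i t, `|picard B y0 u i t - picard B y0 v i t| <= K / 2.
Proof.
move=> Bc Bb small uc vc K0 huv i t.
pose fu s := \sum_j B i j s * u j s; pose fv s := \sum_j B i j s * v j s.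
have fuc : continuous fu by move=> s; apply: cont_sum => j; apply: cont_mul; [exact: Bc|exact: uc].
have fvc : continuous fv by move=> s; apply: cont_sum => j; apply: cont_mul; [exact: Bc|exact: vc].
pose F (s : R) : R := primitive fu s - primitive fv s.
have -> : picard B y0 u i t - picard B y0 v i t = F (clamp t) - F 0.
  rewrite /picard -/(primitive fu (clamp t)) -/(primitive fv (clamp t)).
  by rewrite /F !primitive0; ring.
have [c0 c1] := (clamp_ge0 t, clamp_le1 t).
apply: (@le_trans _ _ (K / 2 * (clamp t - 0))); last first.
  by rewrite subr0 ler_piMr// divr_ge0.
have in01 (s : R) : 0 <= s <= clamp t -> 0 <= s <= 1.
  by move=> /andP[-> h]; rewrite (le_trans h).
apply: (@mean_value_le _ _ (fun s => fu s - fv s)) => // s /in01 s01.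
  by apply: is_derive_sub; exact: is_derive_primitive.
rewrite /fu /fv -sumrB; under eq_bigr do rewrite -mulrBr.
by apply: sum_small small K0 _ _ => j; [exact: Bb|exact: huv].
Qed.

(** Picard iteration.  The smallness of the coefficients makes the iterates
    converge geometrically on the whole unit interval; the general case, with
    its factorial estimates, is avoided since rays can be taken short. *)
Lemma linear_ode (I : finType) (B : I -> I -> R -> R) (y0 : I -> R) (beta : R) :
  (forall i j, continuous (B i j)) ->
  (forall i j t, 0 <= t <= 1 -> `|B i j t| <= beta) -> #|I|%:R * beta <= 2^-1 ->
  exists u : I -> R -> R, (forall i, u i 0 = y0 i) /\
    forall i (t : R), 0 <= t <= 1 -> is_derive t 1 (u i) (\sum_j B i j t * u j t).
Proof.
move=> Bc Bb small.
pose U k := iter k (picard B y0) (fun i _ => y0 i).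
have Uc k i : continuous (U k i).
  elim: k i => [|k IH] i; first exact: cst_continuous.
  exact: picard_continuous.
pose C := \sum_i `|y0 i|.
have C0 : 0 <= C by exact: sumr_ge0.
have p2 k : (0 : R) < 2 ^+ k by rewrite exprn_gt0.
have step k i t : `|U k.+1 i t - U k i t| <= C / 2 ^+ k.+1.
  elim: k i t => [|k IH] i t.
    pose z (i : I) (t : R) : R := 0.
    have zc j : continuous (z j) by exact: cst_continuous.
    have E : U 0 i t = picard B y0 z i t.
      pose f s := \sum_j B i j s * z j s.
      have fc : continuous f.
        by move=> s; apply: cont_sum => j; apply: cont_mul; [exact: Bc|exact: zc].
      have f0 s : f s = 0 by rewrite /f big1// => j _; rewrite mulr0.
      have := @mean_value_le R (primitive f) f 0 0 (clamp t) (clamp_ge0 t).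
      rewrite mul0r primitive0 subr0 normr_le0 => h.
      rewrite /picard -/(primitive f (clamp t)) (eqP (h _ _)) ?addr0// => s.
        move=> /andP[s0 sc]; apply: is_derive_primitive => //.
        by rewrite s0 (le_trans sc)// clamp_le1.
      by rewrite f0 normr0.
    rewrite E expr1; apply: (picard_contracts y0 Bc Bb small (Uc 0%N) zc C0) => j s.
    rewrite subr0 /C (bigD1 j)//= lerDl; exact: sumr_ge0.
  have -> : C / 2 ^+ k.+2 = C / 2 ^+ k.+1 / 2.
    rewrite exprS; field; exact: lt0r_neq0.
  apply: (picard_contracts y0 Bc Bb small (Uc k.+1) (Uc k) _ IH).
  by rewrite divr_ge0// ltW.
pose L i t := sval (cid (geometric_limit C0 (fun k => step k i t))).
have LU k i t : `|L i t - U k i t| <= C / 2 ^+ k.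
  by rewrite /L; case: cid.
have tiny e : 0 < e -> exists k, C / 2 ^+ k < e.
  move=> e0; exists (Num.bound (C / e)).
  by rewrite ltr_pdivrMr// mulrC -ltr_pdivrMr//; exact: upper_nthrootP.
have Lc i : continuous (L i).
  move=> t; apply/cvgrPdist_lt => e e0.
  have [k hk] := tiny (e / 3) ltac:(by rewrite divr_gt0).
  have /cvgrPdist_lt/(_ (e / 3) ltac:(by rewrite divr_gt0)) := Uc k i t.
  apply: filterS => s hs.
  have -> : L i t - L i s = (L i t - U k i t) + (U k i t - U k i s) - (L i s - U k i s) by ring.
  rewrite (le_lt_trans (ler_normB _ _))//.
  rewrite (le_lt_trans (lerD (ler_normD _ _) (lexx _)))//.
  by have := LU k i t; have := LU k i s; lra.
(* the limit is a fixed point, since both sides are within [C / 2 ^+ k] of the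
   iterate of rank [k.+1] *)
have LE i t : L i t = picard B y0 L i t.
  apply/eqP; rewrite -subr_eq0 -normr_le0; apply/ler_addgt0Pl => e e0; rewrite addr0.
  have [k hk] := tiny e e0.
  have -> : L i t - picard B y0 L i t =
      (L i t - U k.+1 i t) - (picard B y0 L i t - picard B y0 (U k) i t) by rewrite /=; ring.
  rewrite (le_trans (ler_normB _ _))//.
  have h1 := LU k.+1 i t.
  have Ck : 0 <= C / 2 ^+ k by rewrite divr_ge0// ltW.
  have h2 := picard_contracts y0 Bc Bb small Lc (Uc k) Ck (LU k) i t.
  have : C / 2 ^+ k.+1 = C / 2 ^+ k / 2 by rewrite exprS; field; exact: lt0r_neq0.
  by lra.
pose f i s := \sum_j B i j s * L j s.
exists (fun i t => y0 i + primitive (f i) t); split=> [i|i t t01].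
  by rewrite primitive0 addr0.
have E j : y0 j + primitive (f j) t = L j t by rewrite LE /picard clamp_id.
under eq_bigr do rewrite E.
have fc : continuous (f i).
  by move=> s; apply: cont_sum => j; apply: cont_mul; [exact: Bc|exact: Lc].
by have := is_derive_add (is_derive_cst (y0 i) t (1:R)) (is_derive_primitive fc t01); rewrite add0r.
Qed.

(** A form of Gronwall's inequality.  Let [m] be the largest value of the
    [`|u i|] on the unit interval; the mean value theorem gives
    [m <= c + m / 2 + eps]. *)
Lemma linear_ode_bound (I : finType) (B : I -> I -> R -> R) (e u : I -> R -> R)
    (beta c eps : R) :
  (forall i j t, 0 <= t <= 1 -> `|B i j t| <= beta) -> #|I|%:R * beta <= 2^-1 ->
  (forall i (t : R), 0 <= t <= 1 -> is_derive t 1 (u i) (\sum_j B i j t * u j t + e i t)) ->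
  (forall i t, 0 <= t <= 1 -> `|e i t| <= eps) -> (forall i, `|u i 0| <= c) ->
  forall i t, 0 <= t <= 1 -> `|u i t| <= 2 * (c + eps).
Proof.
move=> Bb small du eb u0.
have mx i : exists s, 0 <= s <= 1 /\ forall t, 0 <= t <= 1 -> `|u i t| <= `|u i s|.
  have [||s] := @EVT_max R (fun t => `|u i t|) 0 1; first exact: ler01.
    apply/continuous_in_subspaceT => t; rewrite inE /= in_itv /= => t01.
    apply: (@continuous_comp R R R (u i)); last exact: norm_continuous.
    exact: is_derive_cont (du i t t01).
  rewrite in_itv /= => s01 hs; by exists s.
have [s hs] := choice mx.
move=> i0 t0 t01.
(* the component, and with [s i] the time, where the maximum is reached *)
pose i := [arg max_(i > i0) `|u i (s i)|]%O.
have him j : `|u j (s j)| <= `|u i (s i)|.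
  by rewrite /i; case: arg_maxP => // k _ hk; exact: hk.
have [s01 _] := hs i.
have K0 : 0 <= `|u i (s i)| by [].
have hB t j : 0 <= t <= 1 -> `|u j t| <= `|u i (s i)|.
  by move=> t1; rewrite (le_trans ((hs j).2 t t1)).
apply: (le_trans (hB t0 i0 t01)).
have s0 : 0 <= s i by case/andP: s01.
have eps0 : 0 <= eps by apply: (le_trans (normr_ge0 _) (eb i 0 _)); rewrite lexx ler01.
have in01 (t : R) : 0 <= t <= s i -> 0 <= t <= 1.
  by move=> /andP[-> h]; case/andP: s01 => _ /(le_trans h).
have H : `|u i (s i) - u i 0| <= (`|u i (s i)| / 2 + eps) * (s i - 0).
  apply: (@mean_value_le R (u i) (fun t => \sum_j B i j t * u j t + e i t)) => // t /in01 t1.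
    exact: du.
  rewrite (le_trans (ler_normD _ _))// lerD ?eb//.
  by apply: sum_small small K0 _ _ => j; [exact: Bb|exact: hB].
have {}H : `|u i (s i) - u i 0| <= `|u i (s i)| / 2 + eps.
  apply: le_trans H _; rewrite subr0 ler_piMr//; last by case/andP: s01.
  by rewrite addr_ge0// divr_ge0.
have H2 : `|u i (s i)| <= `|u i (s i) - u i 0| + `|u i 0|.
  by rewrite -[X in `|X| <= _](subrK (u i 0)) ler_normD.
by have := u0 i; lra.
Qed.

End LinearODE.

(** * Linear systems along segments *)

Section Frobenius.
Context {R : realType} {n : nat}.
Implicit Types (f : 'rV[R]_n -> R) (x y v w : 'rV[R]_n).
Local Notation e_ i := (delta_mx 0 i : 'rV[R]_n).

Lemma derive_row_sum f x v : differentiable f x ->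
  'D_v f x = \sum_i v 0 i * 'D_(e_ i) f x.
Proof.
move=> df; rewrite deriveE// [in LHS](row_sum_delta v) linear_sum.
by apply: eq_bigr => i _; rewrite linearZ deriveE.
Qed.

Lemma is_derive_segment f v y (t : R) : differentiable f (t *: v + y) ->
  is_derive t 1 (fun s => f (s *: v + y)) (\sum_b v 0 b * 'D_(e_ b) f (t *: v + y)).
Proof.
move=> df; rewrite -derive_row_sum//; apply/is_derive_along/derivableP.
exact: diff_derivable.
Qed.

Lemma ball_segment x0 x1 v (r t : R) : `|x1 - x0| < r -> `|v + x1 - x0| < r ->
  0 <= t <= 1 -> `|t *: v + x1 - x0| < r.
Proof.
move=> h1 h2 /andP[t0 t1].
have -> : t *: v + x1 - x0 = (1 - t) *: (x1 - x0) + t *: (v + x1 - x0).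
  by apply/rowP => j; rewrite !mxE; ring.
apply: le_lt_trans (ler_normD _ _) _; rewrite !normrZ !ger0_norm ?subr_ge0//.
pose m := Num.max `|x1 - x0| `|v + x1 - x0|.
have m1 : `|x1 - x0| <= m by rewrite le_max lexx.
have m2 : `|v + x1 - x0| <= m by rewrite le_max lexx orbT.
apply: (@le_lt_trans _ _ m); last by rewrite gt_max h1.
have -> : m = (1 - t) * m + t * m by ring.
by rewrite lerD// ler_wpM2l// subr_ge0.
Qed.

Lemma ball_small_segment x0 v (r t : R) : `|v| < r -> 0 <= t <= 1 ->
  `|t *: v + x0 - x0| < r.
Proof.
move=> vr t01; apply: ball_segment t01; first by rewrite subrr normr0 (le_lt_trans _ vr).
by rewrite addrK.
Qed.

Lemma sum_le_card (I : finType) (F : I -> R) (K : R) :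
  (forall j, `|F j| <= K) -> `|\sum_j F j| <= #|I|%:R * K.
Proof.
move=> h; apply: le_trans (ler_norm_sum _ _ _) _.
by apply: (le_trans (ler_sum _ (fun j _ => h j))); rewrite sumr_const -[leLHS]mulr_natl.
Qed.

Lemma sum_ord_le (F : 'I_n -> R) (K : R) :
  (forall j, `|F j| <= K) -> `|\sum_j F j| <= n%:R * K.
Proof. by move=> /sum_le_card; rewrite card_ord. Qed.

Lemma mulr_norm_le (a b A B : R) : `|a| <= A -> `|b| <= B -> `|a * b| <= A * B.
Proof. by move=> ha hb; rewrite normrM ler_pM. Qed.

(** On the segment from [x1] to [x] the [y i] solve a linear equation with
    small coefficients and vanishing initial value. *)
Lemma linear_unique (I : finType) (A : 'I_n -> I -> I -> 'rV[R]_n -> R)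
    (y : I -> 'rV[R]_n -> R) x0 x1 (r a : R) :
  (forall b i j x, `|x - x0| < r -> `|A b i j x| <= a) ->
  #|I|%:R * (n%:R * ((r + r) * a)) <= 2^-1 ->
  (forall i x, `|x - x0| < r -> differentiable (y i) x /\
     forall b, 'D_(e_ b) (y i) x = \sum_j A b i j x * y j x) ->
  `|x1 - x0| < r -> (forall i, y i x1 = 0) ->
  forall i x, `|x - x0| < r -> y i x = 0.
Proof.
move=> hA small hy x1r y1 i x xr.
pose v := x - x1.
have vr : `|v| <= r + r.
  have -> : v = (x - x0) - (x1 - x0) by rewrite /v opprB addrA subrK.
  by rewrite (le_trans (ler_normB _ _))// lerD// ltW.
have inb t : 0 <= t <= 1 -> `|t *: v + x1 - x0| < r.
  by apply: ball_segment => //; rewrite /v subrK.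
pose B i j t := \sum_b v 0 b * A b i j (t *: v + x1).
pose u i t := y i (t *: v + x1).
have Bb i' j t : 0 <= t <= 1 -> `|B i' j t| <= n%:R * ((r + r) * a).
  move=> t01; apply: sum_ord_le => b; apply: mulr_norm_le.
    exact: le_trans (row_coord_le _ _) vr.
  by apply: hA; exact: inb.
have du i' (t : R) : 0 <= t <= 1 -> is_derive t 1 (u i') (\sum_j B i' j t * u j t + 0).
  move=> t01; have [df Df] := hy i' _ (inb t t01).
  apply: is_derive_ext (is_derive_segment df) => //.
  rewrite addr0; under eq_bigr do rewrite Df mulr_sumr.
  rewrite exchange_big; apply: eq_bigr => j _ /=.
  by rewrite /B mulr_suml; apply: eq_bigr => b _; rewrite mulrA.
have := @linear_ode_bound R I B (fun _ _ => 0) u (n%:R * ((r + r) * a)) 0 0 Bb small du.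
have h1 : forall (i : I) (t : R), 0 <= t <= 1 -> `|(0 : R)| <= 0 by move=> *; rewrite normr0.
have h2 : forall i, `|u i 0| <= 0 by move=> j; rewrite /u scale0r add0r y1 normr0.
move=> /(_ h1 h2 i 1); rewrite ler01 lexx addr0 mulr0 normr_le0 => /(_ isT)/eqP.
by rewrite /u scale1r /v subrK.
Qed.

Lemma diff_mean_le f x0 w (b : 'I_n) (r s C : R) :
  (forall x, `|x - x0| < r -> differentiable f x) ->
  (forall x, `|x - x0| < r -> `|'D_(e_ b) f x| <= C) ->
  `|w - x0| < r -> `|s *: e_ b + w - x0| < r ->
  `|f (s *: e_ b + w) - f w| <= C * `|s|.
Proof.
move=> df hC wr sr.
pose h t := f (t *: (s *: e_ b) + w).
have -> : f (s *: e_ b + w) - f w = h 1 - h 0 by rewrite /h scale1r scale0r add0r.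
rewrite -[leRHS]mulr1 -[X in _ * X]subr0.
apply: (@mean_value_le R h (fun t => s * 'D_(e_ b) f (t *: (s *: e_ b) + w))) => // t t01.
  have inb := ball_segment wr sr t01.
  apply: is_derive_ext (is_derive_segment (df _ inb)) => //.
  rewrite (bigD1 b)//= big1 ?addr0; last first.
    by move=> c /negbTE cb; rewrite !mxE cb andbF mulr0 mul0r.
  by rewrite !mxE !eqxx mulr1.
rewrite mulrC; apply: mulr_norm_le => //.
by apply: hC; exact: ball_segment.
Qed.

(** First-order Taylor estimate along [e_ b]: the derivative of the error in
    [t] is controlled by [diff_mean_le] for ['D_(e_ b) f]. *)
Lemma diff_taylor_le f x0 w (b : 'I_n) (r s C : R) : 0 <= C ->
  (forall x, `|x - x0| < r -> differentiable f x) ->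
  (forall x, `|x - x0| < r -> differentiable ('D_(e_ b) f) x) ->
  (forall x, `|x - x0| < r -> `|'D_(e_ b) ('D_(e_ b) f) x| <= C) ->
  `|w - x0| < r -> `|s *: e_ b + w - x0| < r ->
  `|f (s *: e_ b + w) - f w - s * 'D_(e_ b) f w| <= C * s ^+ 2.
Proof.
move=> C0 df ddf hC wr sr.
pose D := 'D_(e_ b) f w.
pose h t := f (t *: (s *: e_ b) + w) - t * (s * D).
have -> : f (s *: e_ b + w) - f w - s * D = h 1 - h 0.
  by rewrite /h scale1r scale0r add0r; ring.
have -> : C * s ^+ 2 = `|s| * (C * `|s|) * (1 - 0).
  by rewrite subr0 mulr1 [RHS]mulrCA -normrM -expr2 ger0_norm// sqr_ge0.
apply: (@mean_value_le R h (fun t => s * ('D_(e_ b) f (t *: (s *: e_ b) + w) - D))) => // t t01.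
  have inb := ball_segment wr sr t01.
  rewrite mulrBr; apply: is_derive_sub.
    apply: is_derive_ext (is_derive_segment (df _ inb)) => //.
    rewrite (bigD1 b)//= big1 ?addr0; last first.
      by move=> c /negbTE cb; rewrite !mxE cb andbF mulr0 mul0r.
    by rewrite !mxE !eqxx mulr1.
  have := is_derive_mul (is_derive_id t (1:R)) (is_derive_cst (s * D) t (1:R)).
  by rewrite mul1r mulr0 addr0.
apply: mulr_norm_le => //; rewrite scalerA.
have inb := ball_segment wr sr t01; rewrite scalerA in inb.
apply: le_trans (diff_mean_le ddf hC wr inb) _.
by rewrite ler_wpM2l// normrM ler_piMl// ger0_norm; case/andP: t01.
Qed.

Lemma is_derive_of_quadratic f x v (d K r : R) : 0 < r ->
  (forall s : R, `|s| < r -> `|f (s *: v + x) - f x - s * d| <= K * s ^+ 2) ->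
  is_derive x v f d.
Proof.
move=> r0 h.
have K0 : 0 <= K.
  have r2 : 0 < (r / 2) ^+ 2 by rewrite exprn_gt0// divr_gt0.
  rewrite -(pmulr_lge0 _ r2); apply: le_trans (h (r / 2) _); first exact: normr_ge0.
  by rewrite gtr0_norm ?divr_gt0//; lra.
have lim : (fun s : R => s^-1 *: ((f \o shift x) (s *: v) - f x)) @ 0^' --> d.
  apply/cvgrPdist_le => e e0.
  have d0 : 0 < Num.min r (e / (K + 1)) by rewrite lt_min r0 divr_gt0// ltr_wpDl.
  exists (Num.min r (e / (K + 1))) => // s; rewrite /ball_ /= sub0r normrN lt_min => /andP[sr se] s0.
  have alg (F : R) : d - s^-1 *: F = - (s^-1 * (F - s * d)).
    by rewrite -[s^-1 *: F]/(s^-1 * F); field.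
  rewrite alg.
  rewrite normrN normrM normfV ler_pdivrMl ?normr_gt0//.
  apply: le_trans (h s sr) _.
  rewrite -real_normK ?num_real// expr2 mulrA mulrC ler_wpM2l//.
  rewrite (le_trans (_ : _ <= (K + 1) * `|s|))//; first by rewrite ler_wpM2r// lerDl.
  by rewrite mulrC -ler_pdivlMr ?ltr_wpDl// ltW.
split; first by apply/cvg_ex; exists d.
exact: cvg_lim.
Qed.

End Frobenius.

(** * Flat linear systems of partial differential equations *)

Section FrobeniusAlgebra.
Context {R : comRingType} {n : nat} {I : finType}.
Implicit Types (X : I -> I -> R) (Y : 'I_n -> I -> I -> R) (u : I -> R) (v : 'I_n -> R).

Lemma compose_left X Y u v i :
  \sum_j X i j * (\sum_l (\sum_c v c * Y c j l) * u l) =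
  \sum_l (\sum_c v c * \sum_j X i j * Y c j l) * u l.
Proof.
under eq_bigr do rewrite mulr_sumr; rewrite exchange_big; apply: eq_bigr => l _ /=.
rewrite mulr_suml; under [RHS]eq_bigr do rewrite mulr_sumr mulr_suml.
rewrite [RHS]exchange_big; apply: eq_bigr => j _ /=.
rewrite mulr_suml mulr_sumr; apply: eq_bigr => c _; ring.
Qed.

Lemma compose_right X Y u v i :
  \sum_j (\sum_c v c * Y c i j) * (\sum_l X j l * u l) =
  \sum_l (\sum_c v c * \sum_j Y c i j * X j l) * u l.
Proof.
under eq_bigr do rewrite mulr_sumr; rewrite exchange_big; apply: eq_bigr => l _ /=.
rewrite mulr_suml; under [RHS]eq_bigr do rewrite mulr_sumr mulr_suml.
rewrite [RHS]exchange_big; apply: eq_bigr => j _ /=.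
rewrite mulr_suml; apply: eq_bigr => c _; ring.
Qed.

(** Here [u] and [u'] stand for the solutions at time [t] along the rays with
    directions [v] and [v + s e_b], and [A], [A'] for the coefficients at the
    two points of these rays.  The left-hand side is the time derivative of the
    defect [z = u' - u - t s A_b u].  Flatness replaces the derivatives [DA c b]
    along the ray by derivatives [DA b c] across it, which are the ones that
    occur in the Taylor expansion of [A' - A]; apart from [B' z] only terms of
    second order in [s] are left. *)
Lemma frobenius_algebra (v : 'I_n -> R) (b : 'I_n) (s t : R)
    (A A' : 'I_n -> I -> I -> R) (DA : 'I_n -> 'I_n -> I -> I -> R) (u u' : I -> R)
    (B B' : I -> I -> R) i :
  (forall c i l, DA c b i l + \sum_j A b i j * A c j l =
                 DA b c i l + \sum_j A c i j * A b j l) ->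
  (forall i j, B i j = \sum_c v c * A c i j) ->
  (forall i j, B' i j = \sum_c v c * A' c i j + s * A' b i j) ->
  \sum_j B' i j * u' j - \sum_j B i j * u j
   - (s * \sum_j A b i j * u j
      + t * s * \sum_j ((\sum_c v c * DA c b i j) * u j
                        + A b i j * \sum_l B j l * u l))
  = \sum_j B' i j * (u' j - u j - t * s * \sum_l A b j l * u l)
    + (\sum_j (\sum_c v c * (A' c i j - A c i j - t * s * DA b c i j)
               + s * (A' b i j - A b i j)) * u j
       + t * s * \sum_j (B' i j - B i j) * \sum_l A b j l * u l).
Proof.
move=> flat hB hB'.
have -> : \sum_j ((\sum_c v c * DA c b i j) * u j + A b i j * \sum_l B j l * u l) =
   \sum_j ((\sum_c v c * DA b c i j) * u j + B i j * \sum_l A b j l * u l).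
  rewrite !big_split /=.
  under [X in _ + X = _]eq_bigr do under eq_bigr do rewrite hB.
  under [X in _ = _ + X]eq_bigr do rewrite hB.
  rewrite compose_left compose_right -!big_split; apply: eq_bigr => j _ /=.
  rewrite -!mulrDl -!big_split; congr (_ * _); apply: eq_bigr => c _ /=.
  by rewrite -!mulrDr flat.
have E j : \sum_c v c * (A' c i j - A c i j - t * s * DA b c i j) =
   \sum_c v c * A' c i j - B i j - t * s * \sum_c v c * DA b c i j.
  by rewrite hB mulr_sumr -!sumrB; apply: eq_bigr => c _; ring.
under [X in _ = _ + (X + _)]eq_bigr do rewrite E.
rewrite !mulr_sumr -!sumrB -!big_split /= -!sumrB.
by apply: eq_bigr => j _; rewrite hB'; ring.
Qed.

End FrobeniusAlgebra.

Section FrobeniusTheorem.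
Context {R : realType} {n : nat} {I : finType}.
Implicit Types (x y v w : 'rV[R]_n).
Local Notation e_ i := (delta_mx 0 i : 'rV[R]_n).

(** The inhomogeneous term of the equation for the defect is of second order
    in [s]. *)
Lemma frobenius_remainder (v : 'I_n -> R) (b : 'I_n) (s t C U : R)
    (A A' : 'I_n -> I -> I -> R) (DA : 'I_n -> 'I_n -> I -> I -> R) (u : I -> R)
    (B B' : I -> I -> R) i :
  0 <= C -> 0 <= U -> 0 <= t <= 1 -> (forall c, `|v c| <= 1) ->
  (forall c i j, `|A c i j| <= C) -> (forall c i j, `|A' c i j| <= C) ->
  (forall j, `|u j| <= U) ->
  (forall c i j, `|A' c i j - A c i j| <= C * `|s|) ->
  (forall c i j, `|A' c i j - A c i j - t * s * DA b c i j| <= C * s ^+ 2) ->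
  (forall i j, B i j = \sum_c v c * A c i j) ->
  (forall i j, B' i j = \sum_c v c * A' c i j + s * A' b i j) ->
  `|\sum_j (\sum_c v c * (A' c i j - A c i j - t * s * DA b c i j)
               + s * (A' b i j - A b i j)) * u j
       + t * s * \sum_j (B' i j - B i j) * \sum_l A b j l * u l|
  <= (#|I|%:R * ((n%:R * C + C) * U)
      + #|I|%:R * ((n%:R * C + C) * (#|I|%:R * (C * U)))) * s ^+ 2.
Proof.
move=> C0 U0 /andP[t0 t1] hv hA hA' hu h1 h2 hB hB'.
have s2 : s ^+ 2 = `|s| * `|s| by rewrite -expr2 real_normK// num_real.
apply: le_trans (ler_normD _ _) _; rewrite mulrDl lerD//.
  rewrite -mulrA; apply: sum_le_card => j; rewrite -mulrA [U * _]mulrC mulrA.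
  apply: mulr_norm_le => //; apply: le_trans (ler_normD _ _) _.
  rewrite mulrDl lerD//.
    rewrite -mulrA -[C * _]mul1r; apply: sum_ord_le => c; exact: mulr_norm_le.
  by rewrite s2 mulrCA; exact: mulr_norm_le.
have -> : #|I|%:R * ((n%:R * C + C) * (#|I|%:R * (C * U))) * s ^+ 2 =
   `|s| * (#|I|%:R * ((n%:R * C + C) * `|s| * (#|I|%:R * (C * U)))) by rewrite s2; ring.
apply: mulr_norm_le.
  by rewrite normrM ler_piMl// ger0_norm.
apply: sum_le_card => j; apply: mulr_norm_le; last first.
  by apply: sum_le_card => l; exact: mulr_norm_le.
have -> : B' i j - B i j = \sum_c v c * (A' c i j - A c i j) + s * A' b i j.
  by rewrite hB hB' addrAC -sumrB; congr (_ + _); apply: eq_bigr => c _; ring.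
apply: le_trans (ler_normD _ _) _; rewrite mulrDl lerD//.
  rewrite -mulrA -[C * _]mul1r; apply: sum_ord_le => c; exact: mulr_norm_le.
by rewrite mulrC; exact: mulr_norm_le.
Qed.

(** [row_increment_le] with all the comparison values [D i] equal to 0. *)
Lemma bounded_partials_continuous (f : 'rV[R]_n -> R) x (r e : R) : 0 < r -> 0 <= e ->
  (forall y i, `|y - x| < r -> derivable f y (e_ i)) ->
  (forall y i, `|y - x| < r -> `|'D_(e_ i) f y| <= e) ->
  {for x, continuous f}.
Proof.
move=> r0 e0 df hf; apply/(@cvgrPdist_le _ _ _ (nbhs x)) => d d0.
have K0 : 0 < n%:R * e + 1 by rewrite ltr_wpDl// mulr_ge0.
apply/near_rowP; exists (Num.min r (d / (n%:R * e + 1))).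
  by rewrite lt_min r0 divr_gt0.
move=> y; rewrite lt_min => /andP[yr yd].
have hf' z i : `|z - x| < r -> `|'D_(e_ i) f z - 0| <= e by rewrite subr0; exact: hf.
have := row_increment_le df hf' e0 yr; rewrite subrK big1 ?subr0; last first.
  by move=> i _; rewrite mulr0.
rewrite distrC => h; apply: le_trans h _; rewrite mulrA.
apply: (@le_trans _ _ ((n%:R * e + 1) * `|y - x|)); first by rewrite ler_wpM2r// lerDl.
by rewrite mulrC -ler_pdivlMr// ltW.
Qed.

(** The system restricted to the ray [t |-> t *: v + x0]. *)
Lemma radial_solution (A : 'I_n -> I -> I -> 'rV[R]_n -> R) x0 (r C : R) (y0 : I -> R) :
  (forall b i j x, `|x - x0| < r -> differentiable (A b i j) x) ->
  (forall b i j x, `|x - x0| < r -> `|A b i j x| <= C) ->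
  #|I|%:R * (n%:R * (r * C)) <= 2^-1 ->
  exists u : 'rV[R]_n -> I -> R -> R, forall v, `|v| < r ->
    (forall i, u v i 0 = y0 i) /\
    forall i (t : R), 0 <= t <= 1 -> is_derive t 1 (u v i)
      (\sum_j (\sum_c v 0 c * A c i j (t *: v + x0)) * u v j t).
Proof.
move=> dA hA small.
suff /choice[u hu] : forall v, exists u : I -> R -> R, `|v| < r ->
    (forall i, u i 0 = y0 i) /\
    forall i (t : R), 0 <= t <= 1 -> is_derive t 1 (u i)
      (\sum_j (\sum_c v 0 c * A c i j (t *: v + x0)) * u j t) by exists u.
move=> v; have [vr|_] := ltP `|v| r; last by exists (fun _ _ => 0).
pose B i j t := \sum_c v 0 c * A c i j (clamp t *: v + x0).
have inb t : 0 <= t <= 1 -> `|t *: v + x0 - x0| < r by exact: ball_small_segment.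
have Bc i j : continuous (B i j).
  move=> t; apply: cont_sum => c; apply: cont_mul; first exact: cst_continuous.
  apply: (@continuous_comp R R R clamp (fun s => A c i j (s *: v + x0))).
    exact: clamp_continuous.
  apply: is_derive_cont; apply: is_derive_segment; apply: dA; apply: inb.
  by rewrite clamp_ge0 clamp_le1.
have Bb i j t : 0 <= t <= 1 -> `|B i j t| <= n%:R * (r * C).
  move=> t01; apply: sum_ord_le => c; apply: mulr_norm_le.
    exact: le_trans (row_coord_le _ _) (ltW vr).
  by apply: hA; apply: inb; rewrite clamp_ge0 clamp_le1.
have [u [u0 du]] := linear_ode y0 Bc Bb small.
exists u => _; split=> // i t t01; have := du i t t01.
by rewrite /B clamp_id.
Qed.

(** The solution at [x] is the value at time 1 of the solution along the ray
    from [x0] to [x].  The defect [u' - u - t s A_b u] between the rays to [x]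
    and to [x + s e_b] vanishes at time 0 and satisfies a linear equation with
    an inhomogeneous term of order [s ^+ 2]; by [linear_ode_bound] it is of
    order [s ^+ 2] at time 1, which is the derivative in direction [e_ b]. *)
Lemma frobenius_bounded (A : 'I_n -> I -> I -> 'rV[R]_n -> R) x0 (r C : R) (y0 : I -> R) :
  0 < r -> r <= 1 -> 0 <= C ->
  (forall b i j x, `|x - x0| < r -> differentiable (A b i j) x) ->
  (forall c b i j x, `|x - x0| < r -> differentiable ('D_(e_ b) (A c i j)) x) ->
  (forall b i j x, `|x - x0| < r -> `|A b i j x| <= C) ->
  (forall c b i j x, `|x - x0| < r -> `|'D_(e_ b) (A c i j) x| <= C) ->
  (forall c b i j x, `|x - x0| < r -> `|'D_(e_ b) ('D_(e_ b) (A c i j)) x| <= C) ->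
  (forall b c i l x, `|x - x0| < r ->
     'D_(e_ c) (A b i l) x + \sum_j A b i j x * A c j l x =
     'D_(e_ b) (A c i l) x + \sum_j A c i j x * A b j l x) ->
  #|I|%:R * (n%:R * (r * C)) <= 2^-1 ->
  exists y : I -> 'rV[R]_n -> R, [/\ forall i, y i x0 = y0 i,
    forall i x, `|x - x0| < r -> {for x, continuous (y i)} &
    forall i b x, `|x - x0| < r ->
      is_derive x (e_ b) (y i) (\sum_j A b i j x * y j x)].
Proof.
move=> r0 r1 C0 dA ddA hA hDA hDDA flat small.
have [u hu] := radial_solution y0 dA hA small.
pose Y := \sum_i `|y0 i|.
have Y0 : 0 <= Y by exact: sumr_ge0.
pose U := 2 * (Y + 0).
have U0 : 0 <= U by rewrite mulr_ge0// addr0.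
have Bb v i j t : `|v| < r -> 0 <= t <= 1 ->
    `|\sum_c v 0 c * A c i j (t *: v + x0)| <= n%:R * (r * C).
  move=> vr t01; apply: sum_ord_le => c; apply: mulr_norm_le.
    exact: le_trans (row_coord_le _ _) (ltW vr).
  by apply: hA; exact: ball_small_segment.
have uU v i t : `|v| < r -> 0 <= t <= 1 -> `|u v i t| <= U.
  move=> vr; have [u0 du] := hu v vr.
  apply: (@linear_ode_bound R I (fun i j t => \sum_c v 0 c * A c i j (t *: v + x0))
    (fun _ _ => 0) (u v) _ Y 0 (fun i j t => Bb v i j t vr) small).
  - by move=> j s s01; rewrite addr0; exact: du.
  - by move=> j s _; rewrite normr0.
  - by move=> j; rewrite u0 /Y (bigD1 j)//= lerDl; exact: sumr_ge0.
pose y i x := u (x - x0) i 1.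
suff dy i b x : `|x - x0| < r -> is_derive x (e_ b) (y i) (\sum_j A b i j x * y j x).
  exists y; split=> //.
    move=> i; rewrite /y; rewrite subrr; have [|u0 du] := hu 0; first by rewrite normr0.
    have := @mean_value_le R (u 0 i) _ 0 0 1 ler01 (fun t => du i t).
    rewrite mul0r normr_le0 u0 subr_eq0 => /(_ _)/eqP; apply=> t _.
    rewrite big1 ?normr0// => j _; rewrite big1 ?mul0r// => c _.
    by rewrite mxE mul0r.
  move=> i x xr.
  have inb z : `|z - x| < r - `|x - x0| -> `|z - x0| < r.
    move=> zr; have -> : z - x0 = (z - x) + (x - x0) by rewrite addrA subrK.
    by rewrite (le_lt_trans (ler_normD _ _))// -ltrBrDr.
  have d0 : 0 < r - `|x - x0| by rewrite subr_gt0.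
  have e0 : 0 <= #|I|%:R * (C * U) by rewrite mulr_ge0// mulr_ge0.
  have h1 z b : `|z - x| < r - `|x - x0| -> derivable (y i) z (e_ b).
    by move=> /inb zr; have [] := dy i b z zr.
  have h2 z b : `|z - x| < r - `|x - x0| -> `|'D_(e_ b) (y i) z| <= #|I|%:R * (C * U).
    move=> /inb zr; have [_ ->] := dy i b z zr.
    apply: sum_le_card => j; apply: mulr_norm_le; first exact: hA.
    by apply: uU => //; rewrite lexx ler01.
  exact: bounded_partials_continuous d0 e0 h1 h2.
move=> xr; rewrite /y.
pose v := x - x0.
have vr : `|v| < r by [].
pose K := #|I|%:R * ((n%:R * C + C) * U) + #|I|%:R * ((n%:R * C + C) * (#|I|%:R * (C * U))).
have d0 : 0 < r - `|v| by rewrite subr_gt0.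
apply: (@is_derive_of_quadratic _ _ _ _ _ _ (2 * K) _ d0) => s sd.
have -> : s *: e_ b + x - x0 = s *: e_ b + v by rewrite /v addrA.
(* [v'] is the direction of the ray to the neighbouring point *)
rewrite -/v; pose v' := s *: e_ b + v.
have v'r : `|v'| < r.
  apply: le_lt_trans (ler_normD _ _) _; rewrite normrZ -ltrBrDr.
  by apply: le_lt_trans sd; rewrite ler_piMr// norm_delta_le.
have [u0 du] := hu v vr; have [u0' du'] := hu v' v'r.
have -> : x = 1 *: v + x0 by rewrite scale1r /v subrK.
rewrite -/v'.
pose w t := t *: v + x0; pose w' t := t *: v' + x0.
have wr t : 0 <= t <= 1 -> `|w t - x0| < r by exact: ball_small_segment.
have w'r t : 0 <= t <= 1 -> `|w' t - x0| < r by exact: ball_small_segment.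
have w'E t : w' t = (t * s) *: e_ b + w t.
  by rewrite /w' /w /v' scalerDr scalerA addrA.
pose B t i j := \sum_c v 0 c * A c i j (w t).
pose B' t i j := \sum_c v 0 c * A c i j (w' t) + s * A b i j (w' t).
have B'E t i' j : B' t i' j = \sum_c v' 0 c * A c i' j (w' t).
  have v'c c : v' 0 c = v 0 c + s * (c == b)%:R by rewrite /v' !mxE addrC.
  rewrite /B'; under [RHS]eq_bigr do rewrite v'c mulrDl.
  rewrite big_split /=; congr (_ + _).
  rewrite (bigD1 b)//= big1 ?addr0; last by move=> c /negbTE cb; rewrite cb mulr0 mul0r.
  by rewrite eqxx mulr1.
(* [t * s * F t] is the first-order prediction for [u v' - u v] *)
pose F t i := \sum_l A b i l (w t) * u v l t.
pose z i t := u v' i t - u v i t - t * s * F t i.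
pose e i t := \sum_j (\sum_c v 0 c * (A c i j (w' t) - A c i j (w t) - t * s * 'D_(e_ b) (A c i j) (w t))
               + s * (A b i j (w' t) - A b i j (w t))) * u v j t
       + t * s * \sum_j (B' t i j - B t i j) * F t j.
have dF i' (t : R) : 0 <= t <= 1 -> is_derive t 1 (F^~ i')
   (\sum_j ((\sum_c v 0 c * 'D_(e_ c) (A b i' j) (w t)) * u v j t
             + A b i' j (w t) * \sum_l B t j l * u v l t)).
  move=> t01; apply: is_derive_bigsum => j; apply: is_derive_mul.
    by apply: is_derive_segment; apply: dA; exact: wr.
  exact: du.
have dz i' (t : R) : 0 <= t <= 1 -> is_derive t 1 (z i')
    (\sum_j B' t i' j * z j t + e i' t).
  move=> t01.
  have dts : is_derive t 1 (fun t : R => t * s) s.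
    have := is_derive_mul (is_derive_id t (1:R)) (is_derive_cst s t (1:R)).
    by rewrite mul1r mulr0 addr0.
  have := is_derive_sub (is_derive_sub (du' i' t t01) (du i' t t01)) (is_derive_mul dts (dF i' t t01)).
  apply: is_derive_ext => //.
  rewrite /z /e -(@frobenius_algebra R n I (v 0) b s t (fun c i j => A c i j (w t))
    (fun c i j => A c i j (w' t)) (fun c d i j => 'D_(e_ c) (A d i j) (w t))
    ((u v)^~ t) ((u v')^~ t) (B t) (B' t) i')//; last first.
    by move=> c i1 l; apply: flat; exact: wr.
  by congr (_ - _ - _); apply: eq_bigr => j _; rewrite B'E.
have eb i' t : 0 <= t <= 1 -> `|e i' t| <= K * s ^+ 2.
  move=> t01.
  have ts : `|t * s| <= `|s|.
    by rewrite normrM ler_piMl// ger0_norm; case/andP: t01.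
  have ww := w'r t t01; rewrite w'E in ww.
  apply: (@frobenius_remainder (v 0) b s t C U (fun c i j => A c i j (w t))
    (fun c i j => A c i j (w' t)) (fun c d i j => 'D_(e_ c) (A d i j) (w t))
    ((u v)^~ t) (B t) (B' t) i') => //.
  - by move=> c; apply: le_trans (row_coord_le _ _) _; apply: ltW; exact: lt_le_trans r1.
  - by move=> c i1 j; apply: hA; exact: wr.
  - by move=> c i1 j; apply: hA; exact: w'r.
  - by move=> j; exact: uU.
  - move=> c i1 j; rewrite w'E.
    apply: le_trans (@diff_mean_le _ _ _ x0 _ b r _ C (dA c i1 j) _ (wr t t01) ww) _.
      exact: hDA.
    by rewrite ler_wpM2l.
  - move=> c i1 j; rewrite w'E.
    apply: le_trans (@diff_taylor_le _ _ _ x0 _ b r _ C C0 (dA c i1 j) _ _ (wr t t01) ww) _.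
    + exact: ddA.
    + exact: hDDA.
    + rewrite ler_wpM2l// -(real_normK (num_real (t * s))) -(real_normK (num_real s)).
      by rewrite lerXn2r ?nnegrE.
have z0 i' : `|z i' 0| <= 0 by rewrite /z u0 u0' !mul0r subrr subr0 normr0.
have B'b i' j t : 0 <= t <= 1 -> `|B' t i' j| <= n%:R * (r * C).
  by move=> t01; rewrite B'E; exact: Bb.
have := @linear_ode_bound R I (fun i j t => B' t i j) e z _ 0 (K * s ^+ 2)
  B'b small dz eb z0 i 1.
by rewrite ler01 lexx add0r mulrA /z mul1r; apply.
Qed.

End FrobeniusTheorem.

(** * Calculus in a chart *)

Section ChartCalculus.
Context {R : realType} {n : nat} {M : topologicalType}.
Implicit Types (c : chart R n M) (f g : M -> R) (U V : set M) (x : M).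
Local Notation e_ i := (delta_mx 0 i : 'rV[R]_n).

Lemma near_cinv c x (P : M -> Prop) : cdom c x -> (\forall z \near x, P z) ->
  \forall y \near cmap c x,
    [/\ cdom c (cinv c y), cmap c (cinv c y) = y & P (cinv c y)].
Proof.
move=> cx hP.
have h1 : \forall y \near cmap c x, (cmap c @` cdom c) y.
  by apply: open_nbhs_nbhs; split; [exact: cimg_open|exists x].
have h2 : \forall y \near cmap c x, P (cinv c y).
  have hc : cinv c y @[y --> cmap c x] --> cinv c (cmap c x).
    by apply: cinv_continuous; exists x.
  by rewrite cmapK// in hc; exact: hc.
apply: filterS (near_and h1 h2) => y [[z cz <-]].
by rewrite cmapK.
Qed.

Lemma near_cmap c x (Q : 'rV[R]_n -> Prop) : cdom c x ->
  (\forall y \near cmap c x, Q y) -> \forall z \near x, Q (cmap c z).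
Proof. by move=> cx hQ; exact: (cmap_continuous cx). Qed.

Lemma cont_cinv c f x : cdom c x -> {for x, continuous f} ->
  {for cmap c x, continuous (f \o cinv c)}.
Proof.
move=> cx fc; apply: continuous_comp; first by apply: cinv_continuous; exists x.
by rewrite cmapK.
Qed.

Lemma cont_near_eq {T : topologicalType} (f g : T -> R) (t : T) :
  (\forall y \near t, f y = g y) -> {for t, continuous f} -> {for t, continuous g}.
Proof.
move=> fg fc; have {}fc : f @ t --> f t by [].
rewrite (nbhs_singleton fg) in fc.
exact: cvg_trans (near_eq_cvg fg) fc.
Qed.

(** A relation between a function and its partial derivative; unlike [partial]
    it carries derivability and is stable under the algebraic operations. *)
Definition is_partial c (i : 'I_n) f x (d : R) : Prop :=
  is_derive (cmap c x) (e_ i) (f \o cinv c) d.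

Lemma has_partialP c i f x : has_partial c i f x -> is_partial c i f x (partial c i f x).
Proof. exact: derivableP. Qed.

Lemma partialE c i f x d : is_partial c i f x d -> partial c i f x = d.
Proof. by case. Qed.

Lemma is_partial_has c i f x d : is_partial c i f x d -> has_partial c i f x.
Proof. by case. Qed.

Lemma is_partial_near c i f g x d : cdom c x -> (\forall z \near x, f z = g z) ->
  is_partial c i f x d -> is_partial c i g x d.
Proof.
move=> cx fg; apply: near_eq_is_derive.
by apply: filterS (near_cinv cx fg) => y [].
Qed.

Lemma partial_near c i f g x : cdom c x -> (\forall z \near x, f z = g z) ->
  partial c i f x = partial c i g x.
Proof.
move=> cx fg; apply: near_eq_derive.
by apply: filterS (near_cinv cx fg) => y [].
Qed.

Lemma is_partial_cst c i (a : R) x : is_partial c i (fun=> a) x 0.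
Proof. exact: is_derive_cst. Qed.

Lemma is_partial_add c i f g x df dg : is_partial c i f x df -> is_partial c i g x dg ->
  is_partial c i (fun y => f y + g y) x (df + dg).
Proof. exact: is_derive_add. Qed.

Lemma is_partial_sub c i f g x df dg : is_partial c i f x df -> is_partial c i g x dg ->
  is_partial c i (fun y => f y - g y) x (df - dg).
Proof. exact: is_derive_sub. Qed.

Lemma is_partial_mul c i f g x df dg : cdom c x ->
  is_partial c i f x df -> is_partial c i g x dg ->
  is_partial c i (fun y => f y * g y) x (df * g x + f x * dg).
Proof. by move=> cx hf hg; have := is_derive_mul hf hg; rewrite /= cmapK. Qed.

Lemma is_partial_sum c i (I : Type) (r : seq I) (f : I -> M -> R) x df :
  (forall k, is_partial c i (f k) x (df k)) ->
  is_partial c i (fun y => \sum_(k <- r) f k y) x (\sum_(k <- r) df k).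
Proof. by move=> h; exact: (@is_derive_bigsum R _ I r (fun k => f k \o cinv c) _ _ df h). Qed.

Lemma is_partial_inv c i f x df : cdom c x -> f x != 0 -> is_partial c i f x df ->
  is_partial c i (fun y => (f y)^-1) x (- (df * ((f x)^-1 * (f x)^-1))).
Proof.
move=> cx fx [h <-]; have fx' : (f \o cinv c) (cmap c x) != 0 by rewrite /= cmapK.
split; first exact: derivableV.
rewrite (deriveV fx' h) /= cmapK// -exprVn expr2 scaleNr.
by congr (- _); rewrite [_ *: _]mulrC.
Qed.

Lemma Ck_cont c k U f : Ck c k U f -> forall x, U x -> {for x, continuous f}.
Proof. by case: k => [|k] []. Qed.

Lemma CkS c k U f : Ck c k.+1 U f -> Ck c k U f.
Proof.
elim: k f => [|k IH] f [fc h]; first by split.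
by split=> // i; have [h1 h2] := h i; split=> //; exact: IH.
Qed.

Lemma Ck_sub c k U V f : V `<=` U -> Ck c k U f -> Ck c k V f.
Proof.
move=> VU; elim: k f => [|k IH] f [fc h]; split=> //; try by move=> x /VU/fc.
by move=> i; have [h1 h2] := h i; split; [move=> x /VU/h1|exact: IH].
Qed.

(** Derivatives up to order [k] at a point depend on the function near that
    point only. *)
Lemma Ck_local c k U f :
  (forall x, U x -> exists V, [/\ open V, V x & Ck c k V f]) -> Ck c k U f.
Proof.
elim: k f => [|k IH] f h; split=> //.
- by move=> x /h[V [_ Vx [fc _]]]; exact: fc.
- by move=> x /h[V [_ Vx [fc _]]]; exact: fc.
move=> i; split=> [x /h[V [_ Vx [_ hi]]]|]; first by have [h1 _] := hi i; exact: h1.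
by apply: IH => x /h[V [oV Vx [_ hi]]]; exists V; split=> //; have [] := hi i.
Qed.

Lemma open_near U x : open U -> U x -> \forall z \near x, U z.
Proof. by move=> oU Ux; apply: open_nbhs_nbhs. Qed.

Lemma eq_near U x f g : open U -> U x -> (forall y, U y -> f y = g y) ->
  \forall z \near x, f z = g z.
Proof. by move=> oU Ux fg; apply: filterS (open_near oU Ux). Qed.

Lemma Ck_ext c k U f g : open U -> U `<=` cdom c -> (forall x, U x -> f x = g x) ->
  Ck c k U f -> Ck c k U g.
Proof.
move=> oU Uc; elim: k f g => [|k IH] f g fg [fc h]; split=> //.
- by move=> x Ux; apply: cont_near_eq (fc x Ux); exact: eq_near fg.
- by move=> x Ux; apply: cont_near_eq (fc x Ux); exact: eq_near fg.
move=> i; have [h1 h2] := h i; split.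
  move=> x Ux; apply: is_partial_has.
  by apply: is_partial_near (has_partialP (h1 x Ux)); [exact: Uc|exact: eq_near fg].
apply: IH h2 => x Ux; apply: partial_near; [exact: Uc|exact: eq_near fg].
Qed.

(** The candidate [f'] has to agree with the partial derivatives on [U] only,
    although [partial] is a function on all of [M]. *)
Lemma Ck_intro c k U f (f' : 'I_n -> M -> R) : open U -> U `<=` cdom c ->
  (forall x, U x -> {for x, continuous f}) ->
  (forall i x, U x -> is_partial c i f x (f' i x)) ->
  (forall i, Ck c k U (f' i)) -> Ck c k.+1 U f.
Proof.
move=> oU Uc fc h1 h2; split=> // i; split.
  by move=> x Ux; exact: is_partial_has (h1 i x Ux).
by apply: Ck_ext (h2 i) => // x Ux; rewrite (partialE (h1 i x Ux)).
Qed.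

Lemma Ck_is_partial c k U f i x : Ck c k.+1 U f -> U x -> is_partial c i f x (partial c i f x).
Proof. by case=> _ h Ux; have [h1 _] := h i; exact: has_partialP (h1 x Ux). Qed.

Lemma Ck_partial c k U f i : Ck c k.+1 U f -> Ck c k U (partial c i f).
Proof. by case=> _ /(_ i)[]. Qed.

Lemma Ck_cst c k U (a : R) : open U -> U `<=` cdom c -> Ck c k U (fun=> a).
Proof.
move=> oU Uc; elim: k a => [|k IH] a.
  by split=> // x _; exact: cst_continuous.
apply: (@Ck_intro c k U (fun=> a) (fun _ _ => 0)) => //.
  by move=> x _; exact: cst_continuous.
by move=> i x Ux; exact: is_partial_cst.
Qed.

Lemma Ck_add c k U f g : open U -> U `<=` cdom c ->
  Ck c k U f -> Ck c k U g -> Ck c k U (fun y => f y + g y).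
Proof.
move=> oU Uc; elim: k f g => [|k IH] f g hf hg.
  by split=> // x Ux; apply: cont_add; [exact: (Ck_cont hf)|exact: (Ck_cont hg)].
apply: (@Ck_intro c k U _ (fun i x => partial c i f x + partial c i g x)) => //.
- by move=> x Ux; apply: cont_add; [exact: (Ck_cont hf)|exact: (Ck_cont hg)].
- by move=> i x Ux; apply: is_partial_add; [exact: (Ck_is_partial _ hf Ux)|exact: (Ck_is_partial _ hg Ux)].
- by move=> i; apply: IH; exact: Ck_partial.
Qed.

Lemma Ck_mul c k U f g : open U -> U `<=` cdom c ->
  Ck c k U f -> Ck c k U g -> Ck c k U (fun y => f y * g y).
Proof.
move=> oU Uc; elim: k f g => [|k IH] f g hf hg.
  by split=> // x Ux; apply: cont_mul; [exact: (Ck_cont hf)|exact: (Ck_cont hg)].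
apply: (@Ck_intro c k U _ (fun i x => partial c i f x * g x + f x * partial c i g x)) => //.
- by move=> x Ux; apply: cont_mul; [exact: (Ck_cont hf)|exact: (Ck_cont hg)].
- move=> i x Ux; apply: is_partial_mul; first exact: Uc.
    exact: (Ck_is_partial _ hf Ux).
  exact: (Ck_is_partial _ hg Ux).
- move=> i; apply: Ck_add => //; apply: IH.
  + exact: Ck_partial. + exact: CkS. + exact: CkS. + exact: Ck_partial.
Qed.

Lemma Ck_opp c k U f : open U -> U `<=` cdom c ->
  Ck c k U f -> Ck c k U (fun y => - f y).
Proof.
move=> oU Uc hf; apply: (@Ck_ext c k U (fun y => (-1) * f y)) => //.
  by move=> x _; rewrite mulN1r.
by apply: Ck_mul => //; exact: Ck_cst.
Qed.

Lemma Ck_sum c k U (I : Type) (r : seq I) (f : I -> M -> R) : open U -> U `<=` cdom c ->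
  (forall i, Ck c k U (f i)) -> Ck c k U (fun y => \sum_(i <- r) f i y).
Proof.
move=> oU Uc h; elim: r => [|i r IH].
  by apply: Ck_ext (Ck_cst k 0 oU Uc) => // x _; rewrite big_nil.
by apply: Ck_ext (Ck_add oU Uc (h i) IH) => // x _; rewrite big_cons.
Qed.

Lemma Ck_prod c k U (I : Type) (r : seq I) (f : I -> M -> R) : open U -> U `<=` cdom c ->
  (forall i, Ck c k U (f i)) -> Ck c k U (fun y => \prod_(i <- r) f i y).
Proof.
move=> oU Uc h; elim: r => [|i r IH].
  by apply: Ck_ext (Ck_cst k 1 oU Uc) => // x _; rewrite big_nil.
by apply: Ck_ext (Ck_mul oU Uc (h i) IH) => // x _; rewrite big_cons.
Qed.

Lemma Ck_inv c k U f : open U -> U `<=` cdom c -> (forall x, U x -> f x != 0) ->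
  Ck c k U f -> Ck c k U (fun y => (f y)^-1).
Proof.
move=> oU Uc f0; elim: k f f0 => [|k IH] f f0 hf.
  by split=> // x Ux; apply: continuousV; [exact: f0|exact: (Ck_cont hf)].
apply: (@Ck_intro c k U _ (fun i x => - (partial c i f x * ((f x)^-1 * (f x)^-1)))) => //.
- by move=> x Ux; apply: continuousV; [exact: f0|exact: (Ck_cont hf)].
- move=> i x Ux; apply: is_partial_inv; [exact: Uc|exact: f0|exact: (Ck_is_partial _ hf Ux)].
- move=> i; apply: Ck_opp => //; apply: Ck_mul => //; first exact: Ck_partial.
  by apply: Ck_mul => //; apply: IH => //; exact: CkS.
Qed.

End ChartCalculus.

(** * Change of chart for functions, and chart balls *)

Section ChartChange.
Context {R : realType} {n : nat} {M : topologicalType}.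
Implicit Types (c : chart R n M) (f g : M -> R) (U V : set M) (x : M).
Local Notation e_ i := (delta_mx 0 i : 'rV[R]_n).

Lemma line_continuous (v y : 'rV[R]_n) : continuous (fun s : R => s *: v + y).
Proof.
move=> s; apply: cvgD; last exact: cvg_cst.
first [apply: cvgZr_tmp|apply: cvgZl_tmp]; exact: cvg_id.
Qed.

Lemma near_has_partial c U f x : open U -> U `<=` cdom c -> Ck c 1 U f -> U x ->
  \forall y \near cmap c x, forall i, derivable (f \o cinv c) y (e_ i).
Proof.
move=> oU Uc hf Ux; apply: filterS (near_cinv (Uc x Ux) (open_near oU Ux)).
move=> y [_ yE Uy] i; have [_ /(_ i)[/(_ _ Uy) h _]] := hf.
by rewrite /has_partial yE in h.
Qed.

Lemma near_cinvK c x : cdom c x ->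
  \forall y \near cmap c x, cdom c (cinv c y) /\ cmap c (cinv c y) = y.
Proof.
move=> cx; have h : \forall z \near x, cdom c z by exact: open_near (cdom_open c) cx.
by apply: filterS (near_cinv cx h) => y [].
Qed.

Lemma near_derive_partial c x f i : cdom c x ->
  \forall y \near cmap c x, 'D_(e_ i) (f \o cinv c) y = (partial c i f \o cinv c) y.
Proof.
move=> cx; apply: filterS (near_cinvK cx).
by move=> y [_ yE]; rewrite /partial /= yE.
Qed.

Lemma Ck_differentiable c U f x : open U -> U `<=` cdom c -> Ck c 1 U f -> U x ->
  differentiable (f \o cinv c) (cmap c x).
Proof.
move=> oU Uc hf Ux; have cx := Uc x Ux.
have dc i : {for cmap c x, continuous ('D_(e_ i) (f \o cinv c))}.
  apply: (@cont_near_eq _ _ (partial c i f \o cinv c)).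
    by apply: filterS (near_derive_partial f i cx) => y ->.
  apply: cont_cinv => //; exact: (Ck_cont (Ck_partial i hf)).
exact: (C1_differentiable (near_has_partial oU Uc hf Ux) dc).
Qed.

(** Read in the chart [c'], the coordinate line of [c] through [x] is a curve
    whose velocity is the row of the [partial c i (coord c' j) x]. *)
Lemma chain_rule c c' U f x i : open U -> U `<=` cdom c' -> Ck c' 1 U f ->
  U x -> cdom c x -> (forall j, has_partial c i (coord c' j) x) ->
  is_partial c i f x (\sum_j partial c i (coord c' j) x * partial c' j f x).
Proof.
move=> oU Uc' hf Ux cx hj; have c'x := Uc' x Ux.
apply/is_derive_line.
pose l (s : R) : 'rV[R]_n := s *: e_ i + cmap c x.
pose phi (s : R) : 'rV[R]_n := cmap c' (cinv c (l s)).
have l0 : l 0 = cmap c x by rewrite /l scale0r add0r.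
have phi0 : phi 0 = cmap c' x by rewrite /phi l0 cmapK.
have dphi : is_derive (0 : R) (1 : R) phi (\row_j partial c i (coord c' j) x).
  apply: is_derive_row => j; rewrite mxE.
  exact: (is_derive_line _ _ _ _).1 (has_partialP (hj j)).
have df : differentiable (f \o cinv c') (phi 0).
  by rewrite phi0; exact: Ck_differentiable hf Ux.
have := is_derive_curve dphi df; rewrite derive_row_sum// phi0.
have -> : \sum_i0 (\row_j partial c i (coord c' j) x) 0 i0 * 'D_(e_ i0) (f \o cinv c') (cmap c' x) =
   \sum_j partial c i (coord c' j) x * partial c' j f x.
  by apply: eq_bigr => j _; rewrite mxE.
apply: near_eq_is_derive.
have h1 : \forall y \near cmap c x, cdom c' (cinv c y).
  by apply: filterS (near_cinv cx (open_near (cdom_open c') c'x)) => y [].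
have lc : l s @[s --> (0 : R)] --> l 0.
  exact: line_continuous.
have h2 : \forall s \near (0 : R), cdom c' (cinv c (l s)).
  by rewrite l0 in lc; exact: lc _ h1.
by apply: filterS h2 => s hs; rewrite /= /phi cmapK.
Qed.

(** By [chain_rule] a partial derivative of [f] in [c] is a combination, with
    smooth coefficients, of its partial derivatives in [c'], which are one
    order less regular than [f]. *)
Lemma Ck_change c c' k U f : open U -> U `<=` cdom c -> U `<=` cdom c' ->
  (forall j, smooth_in c U (coord c' j)) -> Ck c' k U f -> Ck c k U f.
Proof.
move=> oU Uc Uc' hj; elim: k f => [|k IH] f hf.
  by split=> // x Ux; exact: (Ck_cont hf).
have hf1 : Ck c' 1 U f by elim: k hf {IH} => // k IH /CkS.
apply: (@Ck_intro _ _ _ c k U f (fun i x => \sum_j partial c i (coord c' j) x * partial c' j f x)) => //.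
- exact: (Ck_cont hf).
- move=> i x Ux; apply: (chain_rule oU Uc' hf1 Ux) => [|j]; first exact: Uc.
  exact: is_partial_has (Ck_is_partial i (hj j 1%N) Ux).
- move=> i; apply: Ck_sum => // j; apply: Ck_mul => //.
    exact: Ck_partial (hj j k.+1).
  by apply: IH; exact: Ck_partial.
Qed.

Lemma partial_schwarz c U f x i j : open U -> U `<=` cdom c -> Ck c 2 U f -> U x ->
  partial c j (partial c i f) x = partial c i (partial c j f) x.
Proof.
move=> oU Uc hf Ux; have cx := Uc x Ux.
have D2 k l : \forall y \near cmap c x,
    'D_(e_ l) ('D_(e_ k) (f \o cinv c)) y = (partial c l (partial c k f) \o cinv c) y.
  apply: filterS (near_cinvK cx) => y [cy yE].
  rewrite /= /partial yE; apply: near_eq_derive; rewrite -yE.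
  exact: near_derive_partial.
have E k l : 'D_(e_ l) ('D_(e_ k) (f \o cinv c)) (cmap c x) = partial c l (partial c k f) x.
  by rewrite (nbhs_singleton (D2 k l)) /= cmapK.
rewrite -!E; apply: schwarz.
- exact: near_has_partial (CkS hf) Ux.
- apply: near_forall => k; apply: filterS (near_cinv cx (open_near oU Ux)).
  move=> y [cy yE Uy] l.
  have hp := Ck_is_partial l (Ck_partial k hf) Uy.
  rewrite /is_partial yE in hp; case: hp => hp _.
  apply: near_eq_derivable hp; have := near_derive_partial f k cy; rewrite yE.
  by apply: filterS => z ->.
- move=> k l; apply: (@cont_near_eq _ _ (partial c l (partial c k f) \o cinv c)).
    by apply: filterS (D2 k l) => y ->.
  apply: cont_cinv => //; exact: (Ck_cont (Ck_partial l (Ck_partial k hf))).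
Qed.

Definition chart_ball c x (r : R) : set M :=
  [set z | cdom c z /\ `|cmap c z - cmap c x| < r].

(** What makes [chart_ball c x r] a faithful copy, inside [U], of a Euclidean
    ball; without it the ball could be cut off by the image of the chart. *)
Definition chart_radius c x U (r : R) : Prop :=
  0 < r /\ forall y, `|y - cmap c x| < r ->
    [/\ cdom c (cinv c y), cmap c (cinv c y) = y & U (cinv c y)].

Lemma chart_radius_le c x U r s : chart_radius c x U r -> 0 < s -> s <= r -> chart_radius c x U s.
Proof. by move=> [_ h] s0 sr; split=> // y ys; apply: h; exact: lt_le_trans sr. Qed.

Lemma chart_ball_sub c x U r : chart_radius c x U r -> chart_ball c x r `<=` U.
Proof. by move=> [_ h] z [cz zr]; have [_ _] := h _ zr; rewrite cmapK. Qed.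

Lemma chart_ball_center c x U r : cdom c x -> chart_radius c x U r -> chart_ball c x r x.
Proof. by move=> cx [r0 _]; split=> //; rewrite subrr normr0. Qed.

Lemma chart_ball_open c x r : open (chart_ball c x r).
Proof.
rewrite openE => z [cz zr]; rewrite /interior.
have h : \forall y \near cmap c z, `|y - cmap c x| < r.
  apply/near_rowP; exists (r - `|cmap c z - cmap c x|); first by rewrite subr_gt0.
  move=> y yr; have -> : y - cmap c x = (y - cmap c z) + (cmap c z - cmap c x).
    by rewrite addrA subrK.
  by rewrite (le_lt_trans (ler_normD _ _))// -ltrBrDr.
exact: near_and (open_near (cdom_open c) cz) (near_cmap cz h).
Qed.

(** A chart ball is a union of images of segments through its centre. *)
Lemma chart_ball_connected c x U r : cdom c x -> chart_radius c x U r ->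
  connected (chart_ball c x r).
Proof.
move=> cx hr; have [r0 h] := hr.
pose seg (z : M) (t : R) : M := cinv c (t *: (cmap c z - cmap c x) + cmap c x).
have segr z t : chart_ball c x r z -> 0 <= t <= 1 ->
    `|t *: (cmap c z - cmap c x) + cmap c x - cmap c x| < r.
  by move=> [cz zr]; exact: ball_small_segment.
have E : chart_ball c x r = \bigcup_(z in chart_ball c x r) (seg z @` `[0, 1]).
  apply/seteqP; split => [z zb|_ [z zb [t + <-]]].
    exists z => //; exists 1; first by rewrite /= in_itv /= lexx ler01.
    by rewrite /seg scale1r subrK cmapK//; case: zb.
  rewrite /= in_itv /= => t01; have yr := segr z t zb t01.
  by have [cy yE _] := h _ yr; split=> //; rewrite yE.
rewrite E; apply: bigcup_connected.
  exists x => z zb; exists 0; first by rewrite /= in_itv /= lexx ler01.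
  by rewrite /seg scale0r add0r cmapK.
move=> z zb; apply: connected_continuous_connected; first exact: segment_connected.
apply: continuous_in_subspaceT => t; rewrite inE /= in_itv /= => t01.
have [cy yE _] := h _ (segr z t zb t01).
apply: (@continuous_comp R 'rV[R]_n M (fun t => t *: (cmap c z - cmap c x) + cmap c x)).
  exact: line_continuous.
by apply: cinv_continuous; eexists; [exact: cy|].
Qed.

End ChartChange.

(** * Linear systems in a chart *)

Section ChartFrobenius.
Context {R : realType} {n : nat} {M : topologicalType}.
Implicit Types (c : chart R n M) (f g : M -> R) (U V : set M) (x : M).
Local Notation e_ i := (delta_mx 0 i : 'rV[R]_n).

Lemma near_bounded {T : topologicalType} (J : finType) (f : J -> T -> R) (t : T) :
  (forall j, {for t, continuous (f j)}) ->
  exists C : R, 0 <= C /\ \forall z \near t, forall j, `|f j z| <= C.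
Proof.
move=> fc; exists (\sum_j (`|f j t| + 1)); split.
  by apply: sumr_ge0 => j _; rewrite addr_ge0.
apply: near_forall => j; have /cvgrPdist_le/(_ 1 ltr01) := fc j.
apply: filterS => z hz; apply: (@le_trans _ _ (`|f j t| + 1)).
  have -> : f j z = f j t - (f j t - f j z) by rewrite subKr.
  by rewrite (le_trans (ler_normB _ _))// lerD2l.
by rewrite (bigD1 j)//= lerDl sumr_ge0// => i _; rewrite addr_ge0.
Qed.

Lemma small_radius (K r0 : R) : 0 <= K -> 0 < r0 ->
  exists r, [/\ 0 < r, r <= r0, r <= 1 & r * K <= 2^-1].
Proof.
(* [K + 1] is positive even when [K] is 0 *)
move=> K0 r00; pose a := (2 * (K + 1))^-1.
have K1 : 0 < 2 * (K + 1) by rewrite mulr_gt0// ltr_wpDl.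
have a0 : 0 < a by rewrite invr_gt0.
exists (Num.min r0 (Num.min 1 a)); split.
- by rewrite !lt_min r00 ltr01 a0.
- by rewrite ge_min lexx.
- by rewrite !ge_min lexx orbT.
apply: (@le_trans _ _ (a * K)); first by rewrite ler_wpM2r// !ge_min lexx !orbT.
by rewrite /a ler_pdivrMl//; lra.
Qed.

Lemma derive2_cinv c f z k l : cdom c z ->
  'D_(e_ l) ('D_(e_ k) (f \o cinv c)) (cmap c z) = partial c l (partial c k f) z.
Proof.
move=> cz; rewrite /partial; apply: near_eq_derive.
exact: near_derive_partial.
Qed.

Lemma Ck_differentiable_partial c U f k z : open U -> U `<=` cdom c -> Ck c 2 U f -> U z ->
  differentiable ('D_(e_ k) (f \o cinv c)) (cmap c z).
Proof.
move=> oU Uc hf Uz.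
have cz := Uc z Uz.
have hd : \forall y \near cmap c z,
    forall l, derivable ('D_(e_ k) (f \o cinv c)) y (e_ l).
  apply: filterS (near_cinv cz (open_near oU Uz)) => y [cy yE Uy] l.
  have hp := Ck_is_partial l (Ck_partial k hf) Uy.
  rewrite /is_partial yE in hp; case: hp => hp _.
  apply: near_eq_derivable hp; have := near_derive_partial f k cy; rewrite yE.
  by apply: filterS => w ->.
have dc l : {for cmap c z, continuous ('D_(e_ l) ('D_(e_ k) (f \o cinv c)))}.
  apply: (@cont_near_eq _ _ (partial c l (partial c k f) \o cinv c)).
    apply: filterS (near_cinvK cz) => y [cy yE].
    by rewrite -[in RHS]yE derive2_cinv.
  apply: cont_cinv => //; exact: (Ck_cont (Ck_partial l (Ck_partial k hf))).
exact: C1_differentiable hd dc.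
Qed.

(** In a small chart ball the coefficients and their derivatives up to order
    two are bounded, and [frobenius_bounded] applies to their coordinate
    expressions. *)
Lemma frobenius_chart (I : finType) c x0 U (A : 'I_n -> I -> I -> M -> R) :
  open U -> U `<=` cdom c -> U x0 ->
  (forall b i j, Ck c 2 U (A b i j)) ->
  (forall x b d i l, U x ->
     partial c d (A b i l) x + \sum_j A b i j x * A d j l x =
     partial c b (A d i l) x + \sum_j A d i j x * A b j l x) ->
  exists r, chart_radius c x0 U r /\ forall y0 : I -> R,
  exists Y : I -> M -> R, [/\ forall i, Y i x0 = y0 i,
    forall i x, chart_ball c x0 r x -> {for x, continuous (Y i)} &
    forall i b x, chart_ball c x0 r x ->
      is_partial c b (Y i) x (\sum_j A b i j x * Y j x)].
Proof.
move=> oU Uc Ux0 hA flat; have cx0 := Uc x0 Ux0.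
have cA (q : 'I_n * I * I) : {for x0, continuous (A q.1.1 q.1.2 q.2)}.
  exact: (Ck_cont (hA _ _ _)).
have cDA (q : 'I_n * 'I_n * I * I) :
    {for x0, continuous (partial c q.1.1.2 (A q.1.1.1 q.1.2 q.2))}.
  exact: (Ck_cont (Ck_partial _ (hA _ _ _))).
have cDDA (q : 'I_n * 'I_n * I * I) :
    {for x0, continuous (partial c q.1.1.2 (partial c q.1.1.2 (A q.1.1.1 q.1.2 q.2)))}.
  exact: (Ck_cont (Ck_partial _ (Ck_partial _ (hA _ _ _)))).
have [C1 [C10 hC1]] := near_bounded cA.
have [C2 [C20 hC2]] := near_bounded cDA.
have [C3 [C30 hC3]] := near_bounded cDDA.
have hall := near_and (open_near oU Ux0) (near_and hC1 (near_and hC2 hC3)).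
have [r1 r10 hr1] := (near_rowP _ _).1 (near_cinv cx0 hall).
pose C := C1 + C2 + C3.
have C0 : 0 <= C by rewrite !addr_ge0.
have [r [r0 rr1 r_1 small]] : exists r, [/\ 0 < r, r <= r1, r <= 1 & r * (#|I|%:R * (n%:R * C)) <= 2^-1].
  by apply: small_radius => //; rewrite !mulr_ge0.
have hr y : `|y - cmap c x0| < r -> exists2 z, cmap c z = y & [/\ U z,
    forall b i j, `|A b i j z| <= C, forall d b i j, `|partial c b (A d i j) z| <= C &
    forall d b i j, `|partial c b (partial c b (A d i j)) z| <= C].
  move=> yr; have [cy yE [Uy [h1 [h2 h3]]]] := hr1 y (lt_le_trans yr rr1).
  exists (cinv c y) => //; split=> //.
  - by move=> b i j; apply: le_trans (h1 (b, i, j)) _; rewrite /C; lra.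
  - by move=> d b i j; apply: le_trans (h2 (d, b, i, j)) _; rewrite /C; lra.
  - by move=> d b i j; apply: le_trans (h3 (d, b, i, j)) _; rewrite /C; lra.
exists r; split.
  by split=> // y yr; have [cy yE [Uy _]] := hr1 y (lt_le_trans yr rr1).
move=> y0.
pose B b i j := A b i j \o cinv c.
have BE b i j z : cdom c z -> B b i j (cmap c z) = A b i j z by move=> cz; rewrite /B /= cmapK.
have [] := @frobenius_bounded R n I B (cmap c x0) r C y0 r0 r_1 C0.
- move=> b i j y /hr[z <- [Uz _ _ _]]; exact: Ck_differentiable (CkS (hA b i j)) Uz.
- move=> d b i j y /hr[z <- [Uz _ _ _]]; exact: Ck_differentiable_partial (hA d i j) Uz.
- by move=> b i j y /hr[z <- [Uz h _ _]]; rewrite BE//; exact: Uc.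
- move=> d b i j y /hr[z <- [Uz _ h _]]; exact: h.
- move=> d b i j y /hr[z <- [Uz _ _ h]]; rewrite derive2_cinv//; exact: Uc.
- move=> b d i l y /hr[z <- [Uz _ _ _]].
  have cz := Uc z Uz.
  under eq_bigr do rewrite !BE//; under [in RHS]eq_bigr do rewrite !BE//.
  exact: flat.
- by apply: le_trans small; rewrite [leRHS]mulrCA [in leRHS](mulrCA r).
move=> y [yx0 yc hy]; exists (fun i => y i \o cmap c); split=> //.
  move=> i x [cx xr]; apply: continuous_comp; first exact: cmap_continuous.
  exact: yc.
move=> i b x [cx xr].
apply: (@near_eq_is_derive _ _ _ (y i)).
  by apply: filterS (near_cinvK cx) => z [cz zE]; rewrite /= zE.
have := hy i b _ xr; apply: is_derive_ext => //.
by apply: eq_bigr => j _; rewrite BE.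
Qed.

(** [linear_unique] in a ball so small that the coefficients are bounded.  The
    second point [x1] is any point of the ball, as is needed when [x0] is only a
    limit of points where the data are known to vanish. *)
Lemma linear_unique_chart (I : finType) c x0 U (A : 'I_n -> I -> I -> M -> R) :
  open U -> U `<=` cdom c -> U x0 ->
  (forall b i j, {for x0, continuous (A b i j)}) ->
  exists r, chart_radius c x0 U r /\ forall Y : I -> M -> R,
    (forall i, Ck c 1 U (Y i)) ->
    (forall i b x, U x -> partial c b (Y i) x = \sum_j A b i j x * Y j x) ->
    forall x1, chart_ball c x0 r x1 -> (forall i, Y i x1 = 0) ->
    forall i x, chart_ball c x0 r x -> Y i x = 0.
Proof.
move=> oU Uc Ux0 hA; have cx0 := Uc x0 Ux0.
have cA (q : 'I_n * I * I) : {for x0, continuous (A q.1.1 q.1.2 q.2)} by exact: hA.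
have [C [C0 hC]] := near_bounded cA.
have [r1 r10 hr1] := (near_rowP _ _).1 (near_cinv cx0 (near_and (open_near oU Ux0) hC)).
have [r [r0 rr1 r_1 small]] : exists r, [/\ 0 < r, r <= r1, r <= 1 & r * (2 * (#|I|%:R * (n%:R * C))) <= 2^-1].
  by apply: small_radius => //; rewrite !mulr_ge0.
exists r; split.
  by split=> // y yr; have [cy yE [Uy _]] := hr1 y (lt_le_trans yr rr1).
move=> Y hY dY x1 [cx1 x1r] Y1 i x [cx xr].
pose B b i j := A b i j \o cinv c.
have hr y : `|y - cmap c x0| < r -> exists2 z, cmap c z = y & [/\ cdom c z, U z &
    forall b i j, `|A b i j z| <= C].
  move=> yr; have [cy yE [Uy h]] := hr1 y (lt_le_trans yr rr1).
  by exists (cinv c y) => //; split=> // b i' j; exact: (h (b, i', j)).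
rewrite -[x in LHS](cmapK cx).
apply: (@linear_unique R n I B (fun i => Y i \o cinv c) (cmap c x0) (cmap c x1) r C _ _ _ x1r _ i (cmap c x) xr).
- by move=> b i' j y /hr[z <- [cz Uz h]]; rewrite /B /= cmapK.
- by apply: le_trans small; have -> : r * (2 * (#|I|%:R * (n%:R * C))) = #|I|%:R * (n%:R * ((r + r) * C)) by ring.
- move=> i' y /hr[z <- [cz Uz _]]; split; first exact: Ck_differentiable (hY i') Uz.
  move=> b; have := dY i' b z Uz; rewrite /partial => ->.
  by apply: eq_bigr => j _; rewrite /B /= cmapK.
- by move=> i'; rewrite /= cmapK.
Qed.

End ChartFrobenius.

(** * Levi-Civita symbols at a point *)

Section Koszul.
Context {R : realType} {n : nat}.
Variables (G : 'M[R]_n) (dG : 'I_n -> 'M[R]_n).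
Hypotheses (Gu : G \in unitmx) (Gs : forall a b, G a b = G b a)
  (dGs : forall e a b, dG e a b = dG e b a).

(** The Christoffel symbols of a metric with value [G] and with partial
    derivatives [dG] at a point. *)
Definition koszul (d a b : 'I_n) : R :=
  2^-1 * \sum_e invmx G d e * (dG a e b + dG b e a - dG e a b).

Lemma invmx_contractl a b : \sum_d G a d * invmx G d b = (a == b)%:R.
Proof. by have := congr1 (fun A : 'M[R]_n => A a b) (mulmxV Gu); rewrite !mxE. Qed.

Lemma invmx_contractr a b : \sum_d invmx G a d * G d b = (a == b)%:R.
Proof. by have := congr1 (fun A : 'M[R]_n => A a b) (mulVmx Gu); rewrite !mxE. Qed.

Lemma invmx_sym a b : invmx G a b = invmx G b a.
Proof.
have GT : G^T = G by apply/matrixP => i j; rewrite mxE.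
by rewrite -[in LHS]GT -trmx_inv mxE.
Qed.

Lemma sum_delta (F : 'I_n -> R) a : \sum_d (d == a)%:R * F d = F a.
Proof.
rewrite (bigD1 a)//= eqxx mul1r big1 ?addr0// => d /negbTE ->.
by rewrite mul0r.
Qed.

Lemma koszul_sym d a b : koszul d a b = koszul d b a.
Proof.
rewrite /koszul; congr (_ * _); apply: eq_bigr => e _.
by rewrite (dGs e a b); congr (_ * _); ring.
Qed.

Lemma koszul_lower f a b :
  \sum_d G f d * koszul d a b = 2^-1 * (dG a f b + dG b f a - dG f a b).
Proof.
rewrite /koszul; under eq_bigr do rewrite mulrCA mulr_sumr.
rewrite -mulr_sumr; congr (_ * _); rewrite exchange_big /=.
transitivity (\sum_e (e == f)%:R * (dG a e b + dG b e a - dG e a b)).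
  apply: eq_bigr => e _; rewrite eq_sym -invmx_contractl mulr_suml.
  by apply: eq_bigr => d _; rewrite mulrA.
exact: sum_delta.
Qed.

(** The metric is parallel for its Levi-Civita connection. *)
Lemma koszul_compat e a b :
  dG e a b = \sum_d koszul d a e * G d b + \sum_d koszul d b e * G a d.
Proof.
have -> : \sum_d koszul d a e * G d b = \sum_d G b d * koszul d a e.
  by apply: eq_bigr => d _; rewrite mulrC (Gs b d).
under [X in _ + X]eq_bigr do rewrite mulrC.
by rewrite !koszul_lower (dGs e b a) (dGs a b e) (dGs b a e); field.
Qed.

(** Uniqueness of the Levi-Civita connection: lower the upper index of [K] and
    eliminate between the three cyclic forms of the compatibility equation. *)
Lemma koszul_unique (K : 'I_n -> 'I_n -> 'I_n -> R) :
  (forall d a b, K d a b = K d b a) ->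
  (forall e a b, dG e a b = \sum_d K d a e * G d b + \sum_d K d b e * G a d) ->
  forall d a b, koszul d a b = K d a b.
Proof.
move=> Ks Kc d a b.
pose L f a b := \sum_d G f d * K d a b.
have Ls f i j : L f i j = L f j i by apply: eq_bigr => m _; rewrite Ks.
have LE e i j : dG e i j = L j i e + L i j e.
  rewrite Kc /L; congr (_ + _); apply: eq_bigr => m _; rewrite mulrC//.
  by rewrite Gs.
transitivity (\sum_f invmx G d f * L f a b).
  rewrite /koszul mulr_sumr; apply: eq_bigr => f _; rewrite !LE.
  by rewrite (Ls b a f) (Ls f b a) (Ls a b f); field.
rewrite /L; under eq_bigr do rewrite mulr_sumr; rewrite exchange_big /=.
transitivity (\sum_m (m == d)%:R * K m a b); last exact: sum_delta.
apply: eq_bigr => m _; rewrite eq_sym -invmx_contractr mulr_suml.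
by apply: eq_bigr => f _; rewrite mulrA.
Qed.

(** The inverse metric is parallel as well: differentiate [G * G^-1 = 1], which
    is the hypothesis on [D], and use [koszul_compat]. *)
Lemma koszul_dinv (D : 'M[R]_n) e :
  (forall a b, \sum_d (dG e a d * invmx G d b + G a d * D d b) = 0) ->
  forall a b, D a b = - \sum_d koszul b d e * invmx G a d
                      - \sum_d koszul a d e * invmx G d b.
Proof.
move=> hD a b.
have GD f : \sum_d G f d * D d b = - \sum_d dG e f d * invmx G d b.
  by apply/eqP; rewrite -subr_eq0 opprK addrC -big_split /= hD.
have -> : D a b = - \sum_f invmx G a f * \sum_d dG e f d * invmx G d b.
  transitivity (\sum_f invmx G a f * \sum_d G f d * D d b); last first.
    by rewrite -sumrN; apply: eq_bigr => f _; rewrite GD mulrN.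
  under eq_bigr do rewrite mulr_sumr; rewrite exchange_big /=.
  rewrite -[LHS](sum_delta (D^~ b) a); apply: eq_bigr => m _.
  rewrite eq_sym -invmx_contractr mulr_suml.
  by apply: eq_bigr => f _; rewrite mulrA.
rewrite -opprD; congr (- _).
have E f : \sum_d dG e f d * invmx G d b =
    koszul b f e + \sum_m G f m * \sum_d koszul m d e * invmx G d b.
  under eq_bigr do rewrite koszul_compat mulrDl.
  rewrite big_split /=; congr (_ + _).
    under eq_bigr do rewrite mulr_suml; rewrite exchange_big /=.
    rewrite -[RHS](sum_delta (fun m => koszul m f e) b); apply: eq_bigr => m _.
    rewrite -invmx_contractl mulr_suml; apply: eq_bigr => d _; ring.
  under eq_bigr do rewrite mulr_suml; rewrite exchange_big /=.
  by apply: eq_bigr => m _; rewrite mulr_sumr; apply: eq_bigr => d _; ring.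
under eq_bigr do rewrite E mulrDr.
rewrite big_split /=; congr (_ + _).
  by apply: eq_bigr => f _; rewrite mulrC.
under eq_bigr do rewrite mulr_sumr; rewrite exchange_big /=.
rewrite -[RHS](sum_delta (fun m => \sum_d koszul m d e * invmx G d b) a).
apply: eq_bigr => m _; rewrite eq_sym -invmx_contractr mulr_suml.
by apply: eq_bigr => f _; rewrite mulrA.
Qed.

End Koszul.

(** * Christoffel symbols and the dual metric *)

Section MetricCalculus.
Context {R : realType} {n : nat} {M : smooth_manifold R n}.
Variable g : chart R n M -> M -> 'M[R]_n.
Hypothesis g_metric : riemannian_metric g.
Implicit Types (c : chart R n M) (U : set M) (x : M).

Lemma metric_sym c x a b : atlas c -> cdom c x -> g c x a b = g c x b a.
Proof.
case: g_metric => _ gs _ ac cx; have /matrixP/(_ b a) := gs c x ac I cx.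
by rewrite mxE.
Qed.

(** A vector in the kernel of [g c x] would have length 0. *)
Lemma metric_unit c x : atlas c -> cdom c x -> g c x \in unitmx.
Proof.
case: g_metric => _ _ gp ac cx; rewrite unitmxE unitfE; apply/negP => /det0P[v v0 vg].
by have := gp c x v ac cx v0; rewrite vg mul0mx mxE ltxx.
Qed.

Lemma metric_Ck c k a b : atlas c -> Ck c k (cdom c) (fun x => g c x a b).
Proof.
by case: g_metric => -[_ gs] _ _ ac; have := gs c a b ac k; rewrite setTI.
Qed.

Definition dmetric c x (e : 'I_n) : 'M[R]_n :=
  \matrix_(a, b) partial c e (fun y => g c y a b) x.

Lemma dmetric_sym c x e a b : atlas c -> cdom c x -> dmetric c x e a b = dmetric c x e b a.
Proof.
move=> ac cx; rewrite !mxE; apply: partial_near => //.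
apply: eq_near (cdom_open c) cx _ => y cy; exact: metric_sym.
Qed.

Lemma christoffelE c d a b x : christoffel g c d a b x = koszul (g c x) (dmetric c x) d a b.
Proof.
by rewrite /christoffel /koszul /ginv; congr (_ * _); apply: eq_bigr => e _; rewrite !mxE.
Qed.

Lemma christoffel_sym c d a b x : atlas c -> cdom c x ->
  christoffel g c d a b x = christoffel g c d b a x.
Proof. by move=> ac cx; rewrite !christoffelE koszul_sym// => *; exact: dmetric_sym. Qed.

Lemma Ck_det c k U m (A : M -> 'M[R]_m) :
  open U -> U `<=` cdom c ->
  (forall i j, Ck c k U (fun x => A x i j)) -> Ck c k U (fun x => \det (A x)).
Proof.
move=> oU Uc hA; rewrite /determinant; apply: Ck_sum => // s.
apply: Ck_mul => //; first exact: Ck_cst.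
by apply: Ck_prod.
Qed.

(** Cramer's formula. *)
Lemma Ck_ginv c k a b : atlas c -> Ck c k (cdom c) (fun x => ginv g c x a b).
Proof.
move=> ac; have oc := cdom_open c.
apply: (@Ck_ext _ _ _ c k (cdom c) (fun x => (\det (g c x))^-1 * \adj (g c x) a b)) => //.
  by move=> x cx; rewrite /ginv /invmx metric_unit// [RHS]mxE.
apply: Ck_mul => //.
  apply: Ck_inv => //; last by apply: Ck_det => // i j; exact: metric_Ck.
  by move=> x cx; have := metric_unit ac cx; rewrite unitmxE unitfE.
apply: (@Ck_ext _ _ _ c k (cdom c) (fun x => (-1) ^+ (b + a) * \det (row' b (col' a (g c x))))) => //.
  by move=> x cx; rewrite mxE.
apply: Ck_mul => //; first exact: Ck_cst.
apply: Ck_det => // i j.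
apply: (@Ck_ext _ _ _ c k (cdom c) (fun x => g c x (lift b i) (lift a j))) => //.
  by move=> x cx; rewrite !mxE.
exact: metric_Ck.
Qed.

Lemma Ck_christoffel c k d a b : atlas c -> Ck c k (cdom c) (christoffel g c d a b).
Proof.
move=> ac; have oc := cdom_open c.
apply: Ck_mul => //; first exact: Ck_cst.
apply: Ck_sum => // e; apply: Ck_mul => //; first exact: Ck_ginv.
apply: Ck_add => //; last by apply: Ck_opp => //; apply: Ck_partial; exact: metric_Ck.
by apply: Ck_add => //; apply: Ck_partial; exact: metric_Ck.
Qed.

Lemma ginv_sym c x a b : atlas c -> cdom c x -> ginv g c x a b = ginv g c x b a.
Proof. by move=> ac cx; apply: invmx_sym => i j; exact: metric_sym. Qed.

Lemma is_partial_ginv c e a b x : atlas c -> cdom c x ->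
  is_partial c e (fun y => ginv g c y a b) x
    (- \sum_d christoffel g c b d e x * ginv g c x a d
     - \sum_d christoffel g c a d e x * ginv g c x d b).
Proof.
move=> ac cx.
have dg i j := Ck_is_partial e (metric_Ck 1 i j ac) cx.
have di i j := Ck_is_partial e (Ck_ginv 1 i j ac) cx.
pose D : 'M[R]_n := \matrix_(i, j) partial c e (fun y => ginv g c y i j) x.
have hD i j : \sum_d (dmetric c x e i d * invmx (g c x) d j + g c x i d * D d j) = 0.
  under eq_bigr do rewrite !mxE.
  have h : is_partial c e (fun y => \sum_d g c y i d * ginv g c y d j) x
    (\sum_d (partial c e (fun y => g c y i d) x * ginv g c x d j
             + g c x i d * partial c e (fun y => ginv g c y d j) x)).
    by apply: is_partial_sum => d; apply: is_partial_mul.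
  have h0 : is_partial c e (fun=> (i == j)%:R) x
    (\sum_d (partial c e (fun y => g c y i d) x * ginv g c x d j
             + g c x i d * partial c e (fun y => ginv g c y d j) x)).
    apply: is_partial_near h => //; apply: eq_near (cdom_open c) cx _ => y cy.
    by rewrite -(invmx_contractl (metric_unit ac cy)).
  by rewrite -(partialE h0) (partialE (is_partial_cst _ _ _ _)).
have -> : - \sum_d christoffel g c b d e x * ginv g c x a d
     - \sum_d christoffel g c a d e x * ginv g c x d b = D a b.
  rewrite (koszul_dinv (metric_unit ac cx) _ _ hD).
  - by congr (- _ - _); apply: eq_bigr => d _; rewrite christoffelE.
  - by move=> i j; exact: metric_sym.
  - by move=> f i j; exact: dmetric_sym.
by rewrite mxE.
Qed.

(** The covariant derivative of [g^{ij}] vanishes, so that only the covariant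
    derivative of [w] contributes; here it is written [h]. *)
Lemma is_partial_conorm2 c b x (w h : 'I_n -> M -> R) : atlas c -> cdom c x ->
  (forall a, is_partial c b (w a) x (\sum_d christoffel g c d a b x * w d x + h a x)) ->
  is_partial c b (fun y => conorm2 g c y (\row_a w a y)) x
    (2 * \sum_i \sum_j ginv g c x i j * w i x * h j x).
Proof.
move=> ac cx dw.
have H : is_partial c b (fun y => \sum_i \sum_j ginv g c y i j * w i y * w j y) x
  (\sum_i \sum_j (((- \sum_d christoffel g c j d b x * ginv g c x i d
     - \sum_d christoffel g c i d b x * ginv g c x d j) * w i x +
     ginv g c x i j * (\sum_d christoffel g c d i b x * w d x + h i x)) * w j x +
     ginv g c x i j * w i x * (\sum_d christoffel g c d j b x * w d x + h j x))).
  apply: is_partial_sum => i; apply: is_partial_sum => j.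
  apply: is_partial_mul => //; apply: is_partial_mul => //.
  exact: is_partial_ginv.
suff E : \sum_i \sum_j (((- \sum_d christoffel g c j d b x * ginv g c x i d
     - \sum_d christoffel g c i d b x * ginv g c x d j) * w i x +
     ginv g c x i j * (\sum_d christoffel g c d i b x * w d x + h i x)) * w j x +
     ginv g c x i j * w i x * (\sum_d christoffel g c d j b x * w d x + h j x))
  = 2 * \sum_i \sum_j ginv g c x i j * w i x * h j x.
  rewrite -E; apply: is_partial_near H => //.
  by near=> y; apply: eq_bigr => i _; apply: eq_bigr => j _; rewrite !mxE.
pose G i j := ginv g c x i j; pose Ga d a := christoffel g c d a b x.
have Gs i j : G i j = G j i by exact: ginv_sym.
rewrite -/G.
transitivity (\sum_i \sum_j ((G i j * h i x * w j x + G i j * w i x * h j x)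
   + (\sum_d G i j * (Ga d i * w d x) * w j x - \sum_d Ga i d * G d j * w i x * w j x)
   + (\sum_d G i j * w i x * (Ga d j * w d x) - \sum_d Ga j d * G i d * w i x * w j x))).
  apply: eq_bigr => i _; apply: eq_bigr => j _.
  have -> : \sum_d G i j * (Ga d i * w d x) * w j x = G i j * (\sum_d Ga d i * w d x) * w j x.
    by rewrite -mulr_suml -mulr_sumr.
  have -> : \sum_d G i j * w i x * (Ga d j * w d x) = G i j * w i x * \sum_d Ga d j * w d x.
    by rewrite -mulr_sumr.
  have -> : \sum_d Ga i d * G d j * w i x * w j x = (\sum_d Ga i d * G d j) * w i x * w j x.
    by rewrite -!mulr_suml.
  have -> : \sum_d Ga j d * G i d * w i x * w j x = (\sum_d Ga j d * G i d) * w i x * w j x.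
    by rewrite -!mulr_suml.
  by rewrite /G /Ga; ring.
have s1 : \sum_i \sum_j \sum_d G i j * (Ga d i * w d x) * w j x =
          \sum_i \sum_j \sum_d Ga i d * G d j * w i x * w j x.
  rewrite exchange_big [RHS]exchange_big; apply: eq_bigr => j _ /=.
  by rewrite exchange_big; apply: eq_bigr => i _; apply: eq_bigr => d _; ring.
have s2 : \sum_i \sum_j \sum_d G i j * w i x * (Ga d j * w d x) =
          \sum_i \sum_j \sum_d Ga j d * G i d * w i x * w j x.
  apply: eq_bigr => i _; rewrite exchange_big.
  by apply: eq_bigr => j _; apply: eq_bigr => d _; ring.
under eq_bigr do rewrite !big_split !sumrN /=.
rewrite !big_split !sumrN /= s1 s2 !subrr !addr0.
rewrite mulr_natl mulr2n; congr (_ + _).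
rewrite exchange_big; apply: eq_bigr => j _; apply: eq_bigr => i _ /=.
by rewrite /G ginv_sym//; ring.
Unshelve. all: by end_near. Qed.

End MetricCalculus.

(** * The linear system and its flatness *)

Section FlatSystem.
Context {R : realType} {n : nat} {M : smooth_manifold R n}.
Variable g : chart R n M -> M -> 'M[R]_n.
Hypothesis g_metric : riemannian_metric g.
Variables (N : set M) (Pi : chart R n M -> M -> 'M[R]_n).
Hypotheses (N_open : open N) (Pi_tensor : tensor2_on N Pi) (Pi_sym : symmetric_on N Pi)
  (gauss : gauss_on g Pi N) (codazzi : codazzi_on g Pi N).
Implicit Types (c : chart R n M) (U : set M) (x : M).

(** Indices of the unknowns: [inl true] for [h], [inl false] for [k] and [inr a]
    for [w_a]. *)
Definition jet_idx := (bool + 'I_n)%type.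

Lemma sum_jet_idx (F : jet_idx -> R) :
  \sum_j F j = F (inl true) + F (inl false) + \sum_d F (inr d).
Proof. by rewrite big_sumType big_bool. Qed.

(** Coefficients of the linear system: the derivative in direction [b] of the
    unknown [i] is the sum over [l] of [jet_matrix c b i l] times the unknown
    [l]. *)
Definition jet_matrix c (b : 'I_n) (i l : jet_idx) (x : M) : R :=
  match i, l with
  | inl true, inr d => (d == b)%:R
  | inl false, inr d => - \sum_m ginv g c x d m * Pi c x m b
  | inr a, inl false => Pi c x a b
  | inr a, inr d => christoffel g c d a b x
  | _, _ => 0
  end.

Lemma Pi_symE c x a b : atlas c -> N x -> cdom c x -> Pi c x a b = Pi c x b a.
Proof.
by move=> ac Nx cx; have /matrixP/(_ b a) := Pi_sym ac Nx cx; rewrite mxE.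
Qed.

Lemma Pi_Ck c k a b : atlas c -> Ck c k (N `&` cdom c) (fun x => Pi c x a b).
Proof. by case: Pi_tensor => _ h ac; exact: h. Qed.

Lemma dom_open c : open (N `&` cdom c).
Proof. by apply: openI => //; exact: cdom_open. Qed.

Lemma Ck_ginv_dom c k a b : atlas c -> Ck c k (N `&` cdom c) (fun x => ginv g c x a b).
Proof. by move=> ac; apply: Ck_sub (Ck_ginv g_metric k a b ac) => x []. Qed.

Lemma Ck_jet_matrix c k b i l : atlas c -> Ck c k (N `&` cdom c) (jet_matrix c b i l).
Proof.
move=> ac; have oU := dom_open c; have Uc : N `&` cdom c `<=` cdom c by move=> x [].
case: i => [[]|a]; case: l => [[]|d]; try exact: Ck_cst.
- apply: Ck_opp => //; apply: Ck_sum => // m; apply: Ck_mul => //.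
    exact: Ck_ginv_dom.
  exact: Pi_Ck.
- exact: Pi_Ck.
- by apply: Ck_sub (Ck_christoffel g_metric k d a b ac).
Qed.

Lemma codazzi_sym c x a b e : atlas c -> N x -> cdom c x ->
  partial c e (fun y => Pi c y a b) x - \sum_d christoffel g c d a e x * Pi c x d b =
  partial c b (fun y => Pi c y a e) x - \sum_d christoffel g c d a b x * Pi c x d e.
Proof.
move=> ac Nx cx; have /eqP := codazzi ac Nx cx a b e.
rewrite mulf_eq0 invr_eq0 pnatr_eq0 /= subr_eq0 /cov_deriv2 => /eqP h.
have E : \sum_d christoffel g c d b e x * Pi c x a d =
         \sum_d christoffel g c d e b x * Pi c x a d.
  by apply: eq_bigr => d _; rewrite (christoffel_sym g_metric).
by rewrite E in h; move/addIr: h.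
Qed.

Lemma gauss_up c x q i j k : atlas c -> N x -> cdom c x ->
  curvature_up g c x q i j k =
  (\sum_m ginv g c x q m * Pi c x m j) * Pi c x i k
  - (\sum_m ginv g c x q m * Pi c x m k) * Pi c x i j.
Proof.
move=> ac Nx cx; have gu := metric_unit g_metric ac cx.
transitivity (\sum_m ginv g c x q m * curvature g c x m i j k); last first.
  rewrite !mulr_suml -sumrB; apply: eq_bigr => m _.
  by rewrite (gauss ac Nx cx); ring.
rewrite /curvature; under eq_bigr do rewrite mulr_sumr; rewrite exchange_big /=.
rewrite -[LHS](sum_delta (fun d => curvature_up g c x d i j k) q); apply: eq_bigr => d _.
rewrite eq_sym -(invmx_contractr gu) mulr_suml.
by apply: eq_bigr => m _; rewrite mulrA.
Qed.

(** The composition [g^-1 Pi] of two symmetric forms is self-adjoint for [Pi]. *)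
Lemma shape_sym c x b e : atlas c -> N x -> cdom c x ->
  \sum_d (\sum_m ginv g c x d m * Pi c x m b) * Pi c x d e =
  \sum_d (\sum_m ginv g c x d m * Pi c x m e) * Pi c x d b.
Proof.
move=> ac Nx cx; under eq_bigr do rewrite mulr_suml.
rewrite exchange_big; apply: eq_bigr => d _ /=.
rewrite mulr_suml; apply: eq_bigr => m _.
by rewrite (ginv_sym g_metric)//; ring.
Qed.

(** The covariant derivative of [g^-1 Pi] is [g^-1] applied to that of [Pi]; the
    term [Gamma^m_be Pi_fm] of either, symmetric in [b] and [e], is left out. *)
Lemma partial_shape c x d b e : atlas c -> N x -> cdom c x ->
  partial c e (fun y => \sum_m ginv g c y d m * Pi c y m b) x
    + \sum_m (\sum_f ginv g c x m f * Pi c x f b) * christoffel g c d m e x =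
  \sum_f ginv g c x d f * (partial c e (fun y => Pi c y f b) x
      - \sum_m christoffel g c m f e x * Pi c x m b).
Proof.
move=> ac Nx cx; have Ux : (N `&` cdom c) x by [].
have h : is_partial c e (fun y => \sum_m ginv g c y d m * Pi c y m b) x
  (\sum_m ((- \sum_f christoffel g c m f e x * ginv g c x d f
     - \sum_f christoffel g c d f e x * ginv g c x f m) * Pi c x m b
     + ginv g c x d m * partial c e (fun y => Pi c y m b) x)).
  apply: is_partial_sum => m; apply: is_partial_mul => //.
    exact: is_partial_ginv.
  exact: Ck_is_partial (Pi_Ck 1 m b ac) Ux.
rewrite (partialE h).
pose G i j := ginv g c x i j; pose Ga i j := christoffel g c i j e x.
pose P i := Pi c x i b; pose dP i := partial c e (fun y => Pi c y i b) x.
rewrite -/G.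
transitivity (\sum_m (G d m * dP m - \sum_f Ga m f * G d f * P m - \sum_f Ga d f * G f m * P m)
  + \sum_m \sum_f G m f * P f * Ga d m).
  congr (_ + _); apply: eq_bigr => m _; last by rewrite mulr_suml.
  by rewrite -!mulr_suml /G /Ga /P /dP; ring.
rewrite !big_split !sumrN /=.
have -> : \sum_m \sum_f G m f * P f * Ga d m = \sum_m \sum_f Ga d f * G f m * P m.
  rewrite exchange_big; apply: eq_bigr => m _; apply: eq_bigr => f _; ring.
rewrite subrK -/P.
have -> : \sum_m \sum_f Ga m f * G d f * P m = \sum_f G d f * \sum_m Ga m f * P m.
  rewrite exchange_big; apply: eq_bigr => f _; rewrite mulr_sumr.
  by apply: eq_bigr => m _; ring.
rewrite -sumrB; apply: eq_bigr => f _; rewrite -mulrBr; congr (_ * (_ - _)).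
Qed.

Lemma gauss_rearrange (p q s t P Q u v : R) :
  p - q + (s - t) = P * u - Q * v -> p + (u * - P + s) = q + (v * - Q + t).
Proof.
move/eqP; rewrite -subr_eq0 => /eqP h; apply/eqP; rewrite -subr_eq0 -h.
by apply/eqP; ring.
Qed.

(** The nine cases are as follows.  The row of [h] expresses the symmetry of
    [Gamma] and of [Pi].  In the row of [w_a], the column of [w_d] is the Gauss
    equation and the column of [k] the Codazzi equation.  In the row of [k],
    the column of [k] is the symmetry of [shape_sym] and the column of [w_d] is
    the Codazzi equation with an index raised.  The coefficients of [h] are
    zero. *)
Lemma jet_matrix_flat c x b e i l : atlas c -> N x -> cdom c x ->
  partial c e (jet_matrix c b i l) x + \sum_j jet_matrix c b i j x * jet_matrix c e j l x =
  partial c b (jet_matrix c e i l) x + \sum_j jet_matrix c e i j x * jet_matrix c b j l x.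
Proof.
move=> ac Nx cx; have Ux : (N `&` cdom c) x by [].
have p0 (k : 'I_n) (a : R) : partial c k (fun=> a) x = 0.
  exact: partialE (is_partial_cst _ _ _ _).
rewrite !sum_jet_idx; case: i => [[]|a]; case: l => [[]|d] /=;
  rewrite ?p0 ?mul0r ?mulr0 ?add0r ?addr0.
- by rewrite !big1// => *; rewrite mulr0.
- by rewrite !sum_delta Pi_symE.
- by rewrite !sum_delta (christoffel_sym g_metric).
- by rewrite !big1// => *; rewrite mulr0.
- under eq_bigr do rewrite mulNr; under [RHS]eq_bigr do rewrite mulNr.
  by rewrite !sumrN shape_sym.
- have pN k f : partial c k (jet_matrix c f (inl false) (inr d)) x =
      - partial c k (fun y => \sum_m ginv g c y d m * Pi c y m f) x.
    apply: partialE.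
    have h : is_partial c k (fun y => \sum_m ginv g c y d m * Pi c y m f) x
       (partial c k (fun y => \sum_m ginv g c y d m * Pi c y m f) x).
      apply: (@Ck_is_partial _ _ _ c 0 (N `&` cdom c)) => //.
      have Uc : N `&` cdom c `<=` cdom c by move=> y [].
      apply: Ck_sum => //; first exact: dom_open.
      move=> m; apply: Ck_mul => //; [exact: dom_open|exact: Ck_ginv_dom|exact: Pi_Ck].
    by have := is_partial_sub (is_partial_cst c k 0 x) h; rewrite sub0r;
      apply: is_derive_ext => // y; rewrite /= sub0r.
  under eq_bigr do rewrite mulNr; under [in RHS]eq_bigr do rewrite mulNr.
  rewrite !sumrN -/(jet_matrix c b (inl false) (inr d)) -/(jet_matrix c e (inl false) (inr d)) !pN -!opprD.
  rewrite !partial_shape//; congr (- _); apply: eq_bigr => f _.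
  by rewrite codazzi_sym.
- by rewrite !big1// => *; rewrite mulr0.
- have := codazzi_sym a b e ac Nx cx.
  set X := partial c e _ x; set Y := partial c b _ x.
  set S := \sum_d _; set T := \sum_d _ => h.
  rewrite -/X -/Y -/S -/T; lra.
- have := gauss_up d a e b ac Nx cx; rewrite /curvature_up sumrB.
  have E k f : \sum_m christoffel g c m a f x * christoffel g c d m k x =
    \sum_m christoffel g c d m k x * christoffel g c m a f x.
    by apply: eq_bigr => m _; rewrite mulrC.
  rewrite -(E e b) -(E b e); exact: gauss_rearrange.
Qed.

End FlatSystem.

(** * Christoffel symbols in two charts *)

Section ChangeOfChart.
Context {R : realType} {n : nat} {M : smooth_manifold R n}.
Variable g : chart R n M -> M -> 'M[R]_n.
Hypothesis g_metric : riemannian_metric g.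
Implicit Types (c : chart R n M) (U : set M) (x : M).

Lemma coord_smooth c c' j : atlas c -> atlas c' ->
  smooth_in c (cdom c `&` cdom c') (Defs.coord c' j).
Proof. by move=> ac ac'; exact: atlas_compat. Qed.

Lemma overlap_open c c' : open (cdom c `&` cdom c').
Proof. by apply: openI; exact: cdom_open. Qed.

Lemma atlas_chain_rule c c' U f x i : atlas c -> atlas c' -> open U -> U `<=` cdom c' ->
  Ck c' 1 U f -> U x -> cdom c x ->
  is_partial c i f x (\sum_j jac c c' x i j * partial c' j f x).
Proof.
move=> ac ac' oU Uc' hf Ux cx.
under eq_bigr do rewrite mxE.
apply: (chain_rule oU Uc' hf Ux cx) => j.
have Wx : (cdom c `&` cdom c') x by split=> //; exact: Uc'.
exact: is_partial_has (Ck_is_partial i (coord_smooth j ac ac' 1%N) Wx).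
Qed.

Lemma metric_change c c' x : atlas c -> atlas c' -> cdom c x -> cdom c' x ->
  g c x = jac c c' x *m g c' x *m (jac c c' x)^T.
Proof. by case: g_metric => -[h _] _ _ ac ac' cx c'x; exact: h. Qed.

Lemma jac_unit c c' x : atlas c -> atlas c' -> cdom c x -> cdom c' x ->
  jac c c' x \in unitmx.
Proof.
move=> ac ac' cx c'x; have := metric_unit g_metric ac cx.
rewrite (metric_change ac ac' cx c'x) !unitmx_mul.
by case/andP => /andP[].
Qed.

Lemma is_partial_jac c c' x e a i : atlas c -> atlas c' -> cdom c x -> cdom c' x ->
  is_partial c e (fun y => jac c c' y a i) x (partial c e (partial c a (Defs.coord c' i)) x).
Proof.
move=> ac ac' cx c'x; have Wx : (cdom c `&` cdom c') x by [].
apply: is_partial_near (Ck_is_partial e (Ck_partial a (coord_smooth i ac ac' 2%N)) Wx) => //.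
by near=> y; rewrite mxE.
Unshelve. all: by end_near. Qed.

Definition djac c c' x e : 'M[R]_n :=
  \matrix_(a, i) partial c e (partial c a (Defs.coord c' i)) x.

Definition gamma_row c x (k : 'I_n) : 'M[R]_n := \matrix_(j, i) christoffel g c i j k x.

(** In index notation
    [K_e(a, i) = d_e J_ai + \sum_jk J_aj J_ek Gamma'^i_jk]: the Christoffel
    symbols of [c] with the upper index already converted to [c']. *)
Definition gamma_pull c c' x e : 'M[R]_n :=
  djac c c' x e + jac c c' x *m \sum_k jac c c' x e k *: gamma_row c' x k.

Lemma djac_sym c c' x e a i : atlas c -> atlas c' -> cdom c x -> cdom c' x ->
  djac c c' x e a i = djac c c' x a e i.
Proof.
move=> ac ac' cx c'x; rewrite [LHS]mxE [RHS]mxE.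
have Wx : (cdom c `&` cdom c') x by [].
by apply: (partial_schwarz _ _ (overlap_open c c') _ (coord_smooth i ac ac' 2%N) Wx) => y [].
Qed.

Lemma gamma_pullE c c' x e a i :
  gamma_pull c c' x e a i = djac c c' x e a i +
   \sum_j \sum_k jac c c' x a j * jac c c' x e k * christoffel g c' i j k x.
Proof.
rewrite mxE; congr (_ + _); rewrite mxE; apply: eq_bigr => j _.
rewrite summxE mulr_sumr; apply: eq_bigr => k _.
have -> : (jac c c' x e k *: gamma_row c' x k) j i =
    jac c c' x e k * christoffel g c' i j k x.
  by rewrite [LHS]mxE [X in _ * X = _]mxE.
by rewrite mulrA.
Qed.

Lemma gamma_pull_sym c c' x e a i : atlas c -> atlas c' -> cdom c x -> cdom c' x ->
  gamma_pull c c' x e a i = gamma_pull c c' x a e i.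
Proof.
move=> ac ac' cx c'x; rewrite [LHS]gamma_pullE [RHS]gamma_pullE.
congr (_ + _); first exact: djac_sym.
rewrite exchange_big; apply: eq_bigr => j _; apply: eq_bigr => k _ /=.
congr (_ * _); [exact: mulrC|exact: christoffel_sym].
Qed.

Lemma dmetric_gamma c x k : atlas c -> cdom c x ->
  dmetric g c x k = gamma_row c x k *m g c x + g c x *m (gamma_row c x k)^T.
Proof.
move=> ac cx; apply/matrixP => a b.
rewrite (koszul_compat (metric_unit g_metric ac cx)); first last.
- by move=> e i j; exact: dmetric_sym.
- by move=> i j; exact: metric_sym.
rewrite [RHS]mxE; congr (_ + _); rewrite mxE; apply: eq_bigr => d _.
  by rewrite mxE christoffelE.
by rewrite !mxE christoffelE mulrC.
Qed.

(** Differentiate [g = J g' J^T] and express the derivatives of [g'] through its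
    own Christoffel symbols. *)
Lemma dmetric_change c c' x e : atlas c -> atlas c' -> cdom c x -> cdom c' x ->
  dmetric g c x e = gamma_pull c c' x e *m g c' x *m (jac c c' x)^T
     + jac c c' x *m g c' x *m (gamma_pull c c' x e)^T.
Proof.
move=> ac ac' cx c'x.
pose J := jac c c' x; pose G := g c' x; pose dJ := djac c c' x e.
pose L := \sum_k J e k *: gamma_row c' x k.
pose D := \sum_k J e k *: dmetric g c' x k.
have DE : D = L *m G + G *m L^T.
  rewrite /D /L mulmx_suml linear_sum /= mulmx_sumr -big_split; apply: eq_bigr => k _ /=.
  by rewrite dmetric_gamma// scalerDr linearZ /= -scalemxAl -scalemxAr.
have -> : dmetric g c x e = (dJ *m G + J *m D) *m J^T + J *m G *m dJ^T.
  apply/matrixP => a b; rewrite mxE.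
  have dgp i j : is_partial c e (fun y => g c' y i j) x (D i j).
    have := atlas_chain_rule e ac ac' (cdom_open c') (fun y h => h) (metric_Ck g_metric 1 i j ac') c'x cx.
    apply: is_derive_ext => //; rewrite /D summxE; apply: eq_bigr => k _.
    by rewrite [RHS]mxE [X in _ = _ * X]mxE.
  have dJp a' i : is_partial c e (fun y => jac c c' y a' i) x (dJ a' i).
    by rewrite /dJ mxE; exact: is_partial_jac.
  have H : is_partial c e (fun y => \sum_j (\sum_i jac c c' y a i * g c' y i j) * jac c c' y b j) x
     (\sum_j ((\sum_i (dJ a i * G i j + J a i * D i j)) * J b j + (\sum_i J a i * G i j) * dJ b j)).
    apply: is_partial_sum => j; apply: is_partial_mul => //.
    by apply: is_partial_sum => i; exact: is_partial_mul.
  have {}H : is_partial c e (fun y => g c y a b) x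
     (\sum_j ((\sum_i (dJ a i * G i j + J a i * D i j)) * J b j + (\sum_i J a i * G i j) * dJ b j)).
    apply: is_partial_near H => //.
    apply: eq_near (overlap_open c c') (conj cx c'x) _ => y [cy c'y].
    rewrite (metric_change ac ac' cy c'y) mxE; apply: eq_bigr => j _.
    by rewrite !mxE; congr (_ * _); apply: eq_bigr => i _; rewrite mxE.
  rewrite (partialE H) mxE big_split /=; congr (_ + _).
    rewrite mxE; apply: eq_bigr => j _; rewrite [(J^T) j b]mxE; congr (_ * _).
    by rewrite big_split !mxE.
  by rewrite mxE; apply: eq_bigr => j _; rewrite [(dJ^T) j b]mxE; congr (_ * _); rewrite mxE.
rewrite DE /gamma_pull -/J -/G -/dJ -/L.
have -> : (dJ + J *m L)^T = dJ^T + L^T *m J^T by rewrite linearD /= trmx_mul.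
rewrite !(mulmxDl, mulmxDr) !mulmxA -!addrA; congr (_ + (_ + _)).
by rewrite addrC.
Qed.

(** Both sides come from symbols which are symmetric and compatible with the
    metric, by [gamma_pull_sym] and [dmetric_change]; [koszul_unique] identifies
    them. *)
Lemma christoffel_change c c' x e a i : atlas c -> atlas c' -> cdom c x -> cdom c' x ->
  \sum_d christoffel g c d a e x * jac c c' x d i = gamma_pull c c' x e a i.
Proof.
move=> ac ac' cx c'x.
pose J := jac c c' x; pose G := g c' x.
have Ju : J \in unitmx by exact: jac_unit.
(* the candidate symbols in the chart [c] *)
pose K d a e := (gamma_pull c c' x e *m invmx J) a d.
have KE d a' e' : christoffel g c d a' e' x = K d a' e'.
  rewrite christoffelE; apply: (koszul_unique (metric_unit g_metric ac cx)).
  - by move=> i' j; exact: metric_sym.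
  - move=> d' i' j; rewrite /K [LHS]mxE [RHS]mxE; apply: eq_bigr => k _.
    by congr (_ * _); exact: gamma_pull_sym.
  - move=> f i' j; rewrite (dmetric_change f ac ac' cx c'x) mxE.
    have gE := metric_change ac ac' cx c'x; rewrite -/J -/G in gE.
    congr (_ + _).
      transitivity ((gamma_pull c c' x f *m invmx J *m g c x) i' j); last by rewrite mxE.
      by rewrite gE !mulmxA mulmxKV.
    transitivity ((g c x *m (gamma_pull c c' x f *m invmx J)^T) i' j).
      rewrite gE trmx_mul !mulmxA -(mulmxA _ J^T) -trmx_mul mulVmx// trmx1 mulmx1//.
    by rewrite mxE; apply: eq_bigr => d' _; rewrite [X in _ * X]mxE mulrC.
transitivity ((gamma_pull c c' x e *m invmx J *m J) a i); last by rewrite mulmxKV.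
by rewrite mxE; apply: eq_bigr => d _; rewrite KE.
Qed.

End ChangeOfChart.

(** * The equation in two charts *)

Section EquationChange.
Context {R : realType} {n : nat} {M : smooth_manifold R n}.
Variable g : chart R n M -> M -> 'M[R]_n.
Hypothesis g_metric : riemannian_metric g.
Implicit Types (c : chart R n M) (U : set M) (x : M).

Lemma dscalar_change c c' U h x : atlas c -> atlas c' -> open U -> U `<=` cdom c' ->
  Ck c' 1 U h -> U x -> cdom c x ->
  dscalar h c x = dscalar h c' x *m (jac c c' x)^T.
Proof.
move=> ac ac' oU Uc' hh Ux cx; apply/rowP => i.
rewrite [LHS]mxE [RHS]mxE (partialE (atlas_chain_rule i ac ac' oU Uc' hh Ux cx)).
by apply: eq_bigr => j _; rewrite [dscalar _ _ _ _ _]mxE [(_^T) _ _]mxE mulrC.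
Qed.

Lemma conorm2E c x (v : 'rV[R]_n) :
  conorm2 g c x v = (v *m invmx (g c x) *m v^T) 0 0.
Proof.
rewrite mxE /conorm2 exchange_big; apply: eq_bigr => b _ /=.
rewrite [X in _ = X * _]mxE mulr_suml; apply: eq_bigr => a _.
by rewrite [(v^T) _ _]mxE /ginv [v 0 a * _]mulrC.
Qed.

Lemma conorm2_change c c' x v : atlas c -> atlas c' -> cdom c x -> cdom c' x ->
  conorm2 g c x (v *m (jac c c' x)^T) = conorm2 g c' x v.
Proof.
move=> ac ac' cx c'x; pose J := jac c c' x.
have Ju : J \in unitmx by exact: (jac_unit g_metric).
have gu := metric_unit g_metric ac cx; have gu' := metric_unit g_metric ac' c'x.
have gE : g c x = J *m g c' x *m J^T by exact: metric_change.
have X1 : g c' x *m (J^T *m invmx (g c x) *m J) = 1%:M.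
  have -> : g c' x *m (J^T *m invmx (g c x) *m J) =
    invmx J *m (J *m g c' x *m J^T) *m invmx (g c x) *m J.
    by rewrite !mulmxA mulVmx// mul1mx.
  by rewrite -gE -(mulmxA (invmx J)) mulmxV// mulmx1 mulVmx.
have X : J^T *m invmx (g c x) *m J = invmx (g c' x).
  by rewrite -[LHS](mulKmx gu') X1 mulmx1.
rewrite !conorm2E -/J trmx_mul trmxK -X; congr (fun_of_matrix _ 0 0).
by rewrite !mulmxA.
Qed.

(** The second derivatives of the change of coordinates, which appear when
    [h_{,a}] is differentiated, cancel against those in the transformation of
    the Christoffel symbols. *)
Lemma hessian_change c c' U h x a b : atlas c -> atlas c' -> open U ->
  U `<=` cdom c -> U `<=` cdom c' -> Ck c' 2 U h -> U x ->
  hessian g h c x a b =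
  \sum_i \sum_k jac c c' x a i * jac c c' x b k * hessian g h c' x i k.
Proof.
move=> ac ac' oU Uc Uc' hh Ux; have cx := Uc x Ux; have c'x := Uc' x Ux.
pose J := jac c c' x.
have pE i y : U y -> partial c i h y = \sum_j jac c c' y i j * partial c' j h y.
  move=> Uy; exact: partialE (atlas_chain_rule i ac ac' oU Uc' (CkS hh) Uy (Uc y Uy)).
have H : partial c b (partial c a h) x = \sum_i (djac c c' x b a i * partial c' i h x
    + J a i * \sum_k J b k * partial c' k (partial c' i h) x).
  apply: partialE.
  have h1 : is_partial c b (fun y => \sum_i jac c c' y a i * partial c' i h y) x
    (\sum_i (djac c c' x b a i * partial c' i h x
    + J a i * \sum_k J b k * partial c' k (partial c' i h) x)).
    apply: is_partial_sum => i; apply: is_partial_mul => //.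
      by rewrite [djac _ _ _ _ _ _]mxE; exact: is_partial_jac.
    exact: atlas_chain_rule ac ac' oU Uc' (Ck_partial i hh) Ux cx.
  by apply: is_partial_near h1 => //; apply: eq_near oU Ux _ => y Uy; rewrite pE.
have G : \sum_d christoffel g c d a b x * partial c d h x =
    \sum_i gamma_pull g c c' x b a i * partial c' i h x.
  under eq_bigr do rewrite pE// mulr_sumr.
  rewrite exchange_big; apply: eq_bigr => i _ /=.
  rewrite -(christoffel_change g_metric b a i ac ac' cx c'x) mulr_suml.
  by apply: eq_bigr => d _; rewrite mulrA.
have alg (D p T S : R) : D * p + T - (D + S) * p = T - S * p by ring.
rewrite /hessian H G.
transitivity (\sum_i (J a i * \sum_k J b k * partial c' k (partial c' i h) x
  - (\sum_j \sum_k J a j * J b k * christoffel g c' i j k x) * partial c' i h x)).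
  rewrite -sumrB; apply: eq_bigr => i _; rewrite gamma_pullE -/J.
  exact: alg.
rewrite sumrB.
under [in RHS]eq_bigr do under eq_bigr do rewrite mulrBr.
under [in RHS]eq_bigr do rewrite sumrB.
rewrite [RHS]sumrB; congr (_ - _).
  by apply: eq_bigr => i _; rewrite mulr_sumr; apply: eq_bigr => k _; rewrite mulrA.
under eq_bigr do rewrite mulr_suml; rewrite exchange_big; apply: eq_bigr => j _ /=.
under eq_bigr do rewrite mulr_suml; rewrite exchange_big; apply: eq_bigr => k _ /=.
by rewrite mulr_sumr; apply: eq_bigr => i _; rewrite [RHS]mulrA.
Qed.

(** The equation between tensors need only be verified in one chart. *)
Lemma solves_on_of_chart (N : set M) (Pi : chart R n M -> M -> 'M[R]_n) c S h :
  tensor2_on N Pi -> atlas c -> open S -> S `<=` N -> S `<=` cdom c ->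
  (forall k, Ck c k S h) ->
  (forall x, S x -> conorm2 g c x (dscalar h c x) < 1 /\
     forall a b, Pi c x a b = hessian g h c x a b /
        Num.sqrt (1 - conorm2 g c x (dscalar h c x))) ->
  solves_on g Pi S h.
Proof.
move=> [PiT _] ac oS SN Sc hh eqs; split.
  move=> c' ac' k.
  have oU : open (S `&` cdom c') by apply: openI => //; exact: cdom_open.
  apply: (@Ck_change _ _ _ c' c k) => //.
  - by move=> y [/Sc].
  - move=> j m; apply: Ck_sub (coord_smooth j ac' ac m) => y [/Sc ? ?] //.
  - by apply: Ck_sub (hh k) => y [].
move=> c' x ac' Sx c'x.
have cx := Sc x Sx.
pose U := cdom c' `&` S.
have oU : open U by apply: openI => //; exact: cdom_open.
have Ux : U x by [].
have hU k : Ck c k U h by apply: Ck_sub (hh k) => y [].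
have Uc : U `<=` cdom c by move=> y [_ /Sc].
have Uc' : U `<=` cdom c' by move=> y [].
have E := dscalar_change ac' ac oU Uc (hU 1%N) Ux c'x.
have E2 : conorm2 g c' x (dscalar h c' x) = conorm2 g c x (dscalar h c x).
  by rewrite E conorm2_change.
have [lt1 eq] := eqs x Sx.
rewrite E2; split=> // a b.
rewrite (PiT c' c x ac' ac (SN x Sx) c'x cx) (hessian_change a b ac' ac oU Uc' Uc (hU 2%N) Ux).
rewrite mxE exchange_big mulr_suml; apply: eq_bigr => k _ /=.
rewrite [X in X * _]mxE !mulr_suml; apply: eq_bigr => i _.
rewrite [((jac c' c x)^T) _ _]mxE eq; ring.
Qed.

End EquationChange.

(** * Uniqueness *)

Section Solutions.
Context {R : realType} {n : nat} {M : smooth_manifold R n}.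
Variable g : chart R n M -> M -> 'M[R]_n.
Hypothesis g_metric : riemannian_metric g.
Variables (N : set M) (Pi : chart R n M -> M -> 'M[R]_n).
Hypotheses (N_open : open N) (Pi_tensor : tensor2_on N Pi) (Pi_sym : symmetric_on N Pi)
  (gauss : gauss_on g Pi N) (codazzi : codazzi_on g Pi N).
Implicit Types (c : chart R n M) (S U : set M) (x : M).

Lemma is_partial_sqrt c i (f : M -> R) x d : cdom c x -> 0 < f x -> is_partial c i f x d ->
  is_partial c i (fun y => Num.sqrt (f y)) x (d / (2 * Num.sqrt (f x))).
Proof.
move=> cx fx /is_derive_line hf; apply/is_derive_line.
pose l (s : R) := (f \o cinv c) (s *: delta_mx 0 i + cmap c x).
have l0 : l 0 = f x by rewrite /l /= scale0r add0r cmapK.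
have h : is_derive (l 0) 1 Num.sqrt (2 * Num.sqrt (f x))^-1.
  by rewrite l0; exact: is_derive1_sqrt.
by rewrite mulrC; exact: (is_derive1_comp h hf).
Qed.

(** The unknown [k] of a solution. *)
Definition normal_part c h x : R := Num.sqrt (1 - conorm2 g c x (dscalar h c x)).

(** The unknowns of the linear system which a function [h] defines. *)
Definition jet c (h : M -> R) (i : @jet_idx n) : M -> R :=
  match i with
  | inl true => h
  | inl false => normal_part c h
  | inr a => partial c a h
  end.

(** The equation for [w] is the definition of the Hessian.  That of [k] follows
    by differentiating [k^2 = 1 - |w|^2], which is positive. *)
Lemma solution_jet c S h : atlas c -> open S -> S `<=` N -> solves_on g Pi S h ->
  (forall i, Ck c 1 (S `&` cdom c) (jet c h i)) /\
  forall i b x, (S `&` cdom c) x ->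
    is_partial c b (jet c h i) x (\sum_j jet_matrix g Pi c b i j x * jet c h j x).
Proof.
move=> ac oS SN [sh eqs]; pose U := S `&` cdom c.
have oU : open U by apply: openI => //; exact: cdom_open.
have Uc : U `<=` cdom c by move=> y [].
have UN : U `<=` N `&` cdom c by move=> y [/SN].
have hC k : Ck c k U h := sh c ac k.
have wC k a : Ck c k U (partial c a h) by exact: Ck_partial (hC k.+1).
have AC k b i l : Ck c k U (jet_matrix g Pi c b i l).
  by apply: Ck_sub UN _; exact: Ck_jet_matrix.
have eqx x a b : U x -> 0 < 1 - conorm2 g c x (dscalar h c x) /\
   hessian g h c x a b = Pi c x a b * normal_part c h x.
  move=> [Sx cx]; have [lt1 E] := eqs c x ac Sx cx; rewrite subr_gt0; split=> //.
  by rewrite E /normal_part divfK// gt_eqF// sqrtr_gt0 subr_gt0.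
have dw a b x : U x -> is_partial c b (partial c a h) x
    (\sum_d christoffel g c d a b x * partial c d h x + Pi c x a b * normal_part c h x).
  move=> Ux; have [_ <-] := eqx x a b Ux; rewrite /hessian addrC subrK.
  exact: Ck_is_partial (wC 1%N a) Ux.
have dk b x : U x -> is_partial c b (normal_part c h) x
    (\sum_d (- \sum_m ginv g c x d m * Pi c x m b) * partial c d h x).
  move=> Ux; have [k2 _] := eqx x b b Ux; have cx := Uc x Ux.
  have kp : 0 < normal_part c h x by rewrite sqrtr_gt0.
  have := @is_partial_conorm2 _ _ _ g g_metric c b x (fun a => partial c a h)
    (fun a y => Pi c y a b * normal_part c h y) ac cx (fun a => dw a b x Ux).
  move=> /(is_partial_sub (is_partial_cst c b 1 x)) /(is_partial_sqrt cx k2).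
  rewrite -/(dscalar h c x) -/(normal_part c h x) sub0r.
  apply: is_derive_ext => //.
  have -> : \sum_i \sum_j ginv g c x i j * partial c i h x * (Pi c x j b * normal_part c h x) =
     (\sum_d (\sum_m ginv g c x d m * Pi c x m b) * partial c d h x) * normal_part c h x.
    rewrite mulr_suml; apply: eq_bigr => i _; rewrite !mulr_suml.
    by apply: eq_bigr => j _; ring.
  under [RHS]eq_bigr do rewrite mulNr.
  by rewrite sumrN; field; rewrite gt_eqF.
have eqE i b x : U x ->
    is_partial c b (jet c h i) x (\sum_j jet_matrix g Pi c b i j x * jet c h j x).
  move=> Ux; rewrite sum_jet_idx; case: i => [[]|a] /=; rewrite ?mul0r ?add0r.
  - by rewrite sum_delta; exact: Ck_is_partial (hC 1%N) Ux.
  - exact: dk.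
  - by rewrite addrC; exact: dw.
have kc x : U x -> {for x, continuous (normal_part c h)}.
  move=> Ux; apply: continuous_comp; last exact: sqrt_continuous.
  apply: (@cont_add _ _ (fun=> 1)); first exact: cst_continuous.
  apply: cont_opp; apply: cont_sum => i; apply: cont_sum => j.
  apply: cont_mul; last first.
    apply: (@cont_near_eq _ _ (partial c j h)); last exact: (Ck_cont (wC 0%N j)).
    by near=> y; rewrite mxE.
  apply: cont_mul; first exact: (Ck_cont (Ck_ginv g_metric 0 i j ac) (Uc x Ux)).
  apply: (@cont_near_eq _ _ (partial c i h)); last exact: (Ck_cont (wC 0%N i)).
  by near=> y; rewrite mxE.
split=> //; case=> [[]|a]; [exact: (hC 1%N)| |exact: (wC 1%N)].
apply: (@Ck_intro _ _ _ c 0 U (normal_part c h) (fun b x =>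
   \sum_d (- \sum_m ginv g c x d m * Pi c x m b) * partial c d h x)) => //.
move=> b; have H d := Ck_mul oU Uc (AC 0%N b (inl false) (inr d)) (wC 0%N d).
exact: (Ck_sum _ oU Uc H).
Unshelve. all: by end_near. Qed.

(** The difference of the two jets solves the linear system of
    [linear_unique_chart]. *)
Lemma local_unique c S h h' x0 : atlas c -> open S -> S `<=` N ->
  solves_on g Pi S h -> solves_on g Pi S h' -> S x0 -> cdom c x0 ->
  exists r, chart_radius c x0 (S `&` cdom c) r /\
    forall x1, chart_ball c x0 r x1 -> h x1 = h' x1 -> dscalar h c x1 = dscalar h' c x1 ->
    forall x, chart_ball c x0 r x -> h x = h' x.
Proof.
move=> ac oS SN sh sh' Sx0 cx0; pose U := S `&` cdom c.
have oU : open U by apply: openI => //; exact: cdom_open.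
have Uc : U `<=` cdom c by move=> y [].
have Ux0 : U x0 by [].
have UN : U `<=` N `&` cdom c by move=> y [/SN].
have cA b i j : {for x0, continuous (jet_matrix g Pi c b i j)}.
  have h0 : Ck c 0 (N `&` cdom c) (jet_matrix g Pi c b i j) by exact: Ck_jet_matrix.
  exact: (Ck_cont h0 (UN _ Ux0)).
have [r [hr uniq]] := linear_unique_chart oU Uc Ux0 cA.
exists r; split=> // x1 x1b h1 d1 x xb.
have [C1 P1] := solution_jet ac oS SN sh; have [C2 P2] := solution_jet ac oS SN sh'.
apply/eqP; rewrite -subr_eq0; apply/eqP.
apply: (uniq (fun i y => jet c h i y - jet c h' i y) _ _ x1 x1b _ (inl true) x xb).
- by move=> i; apply: Ck_add => //; apply: Ck_opp.
- move=> i b y Uy; rewrite (partialE (is_partial_sub (P1 i b y Uy) (P2 i b y Uy))) -sumrB.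
  by apply: eq_bigr => j _; rewrite mulrBr.
- case=> [[]|a] /=; first by rewrite h1 subrr.
    by rewrite /normal_part d1 subrr.
  by have := congr1 (fun v : 'rV[R]_n => v 0 a) d1; rewrite !mxE => ->; rewrite subrr.
Qed.

(** The set [C] of points near which the two solutions coincide is open by
    definition.  If [x] is in its closure, a chart ball around [x] contains a
    point of [C], where the jets agree, and [local_unique] applies. *)
Lemma solution_unique S h h' p : connected S -> open S -> S `<=` N -> S p ->
  solves_on g Pi S h -> solves_on g Pi S h' -> h p = h' p ->
  (forall c, atlas c -> cdom c p -> dscalar h c p = dscalar h' c p) ->
  forall x, S x -> h x = h' x.
Proof.
move=> cS oS SN Sp sh sh' hp dp.
pose C : set M := [set x : M | \forall y \near x, h y = h' y].
have oC : open C.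
  by rewrite openE => x; rewrite /C /= => hx; exact: nbhs_interior hx.
have local x : S x -> exists c r, [/\ atlas c, cdom c x, chart_radius c x (S `&` cdom c) r &
    forall x1, chart_ball c x r x1 -> h x1 = h' x1 -> dscalar h c x1 = dscalar h' c x1 ->
    C x].
  move=> Sx; have [c ac cx] := atlas_cover x.
  have [r [hr uniq]] := local_unique ac oS SN sh sh' Sx cx.
  exists c, r; split=> // x1 x1b h1 d1.
  apply: filterS (uniq x1 x1b h1 d1) _.
  exact: open_near (chart_ball_open c x r) (chart_ball_center cx hr).
have Cp : C p.
  have [c [r [ac cp hr uniq]]] := local p Sp.
  by apply: (uniq p) => //; [exact: chart_ball_center hr|exact: dp].
have SC : S `&` C = S.
  apply: cS.
  - by exists p.
  - by exists C.
  - exists (closure C); first exact: closed_closure.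
    apply/seteqP; split=> [x [Sx Cx]|x [Sx Cx]]; split=> //; first exact: subset_closure.
    have [c [r [ac cx hr uniq]]] := local x Sx.
    have nb : nbhs x (chart_ball c x r).
      exact: open_near (chart_ball_open c x r) (chart_ball_center cx hr).
    have [x1 [Cx1 x1b]] := Cx _ nb.
    apply: (uniq x1 x1b); first exact: nbhs_singleton Cx1.
    by apply/rowP => a; rewrite !mxE; apply: partial_near => //; case: x1b.
by move=> x Sx; move: (Sx); rewrite -{1}SC => -[_ /nbhs_singleton].
Qed.

End Solutions.

(** * Local existence *)

Section Existence.
Context {R : realType} {n : nat} {M : smooth_manifold R n}.
Variable g : chart R n M -> M -> 'M[R]_n.
Hypothesis g_metric : riemannian_metric g.
Variables (N : set M) (Pi : chart R n M -> M -> 'M[R]_n).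
Hypotheses (N_open : open N) (Pi_tensor : tensor2_on N Pi) (Pi_sym : symmetric_on N Pi)
  (gauss : gauss_on g Pi N) (codazzi : codazzi_on g Pi N).
Implicit Types (c : chart R n M) (S U V : set M) (x : M).

(** [linear_unique] for the equation [d f = 0]. *)
Lemma zero_on_chart_ball c x0 U r (f : M -> R) : cdom c x0 -> chart_radius c x0 U r ->
  Ck c 1 (chart_ball c x0 r) f ->
  (forall i x, chart_ball c x0 r x -> partial c i f x = 0) -> f x0 = 0 ->
  forall x, chart_ball c x0 r x -> f x = 0.
Proof.
move=> cx0 hr hf df f0 x [cx xr]; have [r0 h] := hr.
have oB := chart_ball_open c x0 r.
have Bc : chart_ball c x0 r `<=` cdom c by move=> y [].
have ball_pt y : `|y - cmap c x0| < r -> exists2 z, cmap c z = y & chart_ball c x0 r z.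
  move=> yr; have [cy yE _] := h y yr; exists (cinv c y) => //; split=> //.
  by rewrite yE.
rewrite -[x in LHS](cmapK cx).
apply: (@linear_unique R n unit (fun _ _ _ _ => 0) (fun _ => f \o cinv c)
  (cmap c x0) (cmap c x0) r 0 _ _ _ _ _ tt (cmap c x) xr).
- by move=> *; rewrite normr0.
- by rewrite !mulr0 invr_ge0.
- move=> _ y /ball_pt[z <- zb]; split; first exact: Ck_differentiable hf zb.
  move=> b; rewrite big1 => [|j _]; last by rewrite mul0r.
  exact: (df b z zb).
- by rewrite subrr normr0.
- by move=> _; rewrite /= cmapK.
Qed.

(** Solutions of a linear system with smooth coefficients gain one derivative
    at a time. *)
Lemma Ck_bootstrap (I : finType) c V (A : 'I_n -> I -> I -> M -> R) (Y : I -> M -> R) :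
  open V -> V `<=` cdom c -> (forall k b i j, Ck c k V (A b i j)) ->
  (forall i x, V x -> {for x, continuous (Y i)}) ->
  (forall i b x, V x -> is_partial c b (Y i) x (\sum_j A b i j x * Y j x)) ->
  forall k i, Ck c k V (Y i).
Proof.
move=> oV Vc hA Yc dY; elim=> [|k IH] i; first by split=> // x; exact: Yc.
apply: (@Ck_intro _ _ _ c k V (Y i) (fun b x => \sum_j A b i j x * Y j x)) => //.
- exact: Yc.
- by move=> b x; exact: dY.
- by move=> b; apply: Ck_sum => // j; apply: Ck_mul.
Qed.

(** Solve the linear system with initial values [h0], [w0] and
    [k = (1 - |w0|^2)^{1/2}].  The function [q = k^2 + |w|^2 - 1] has vanishing
    differential and vanishes at [x0], hence on the whole ball; on a smaller
    ball [k] is positive and therefore equal to the square root of [1 - |w|^2]. *)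
Lemma local_solution c x0 (h0 : R) (w0 : 'rV[R]_n) : atlas c -> N x0 -> cdom c x0 ->
  conorm2 g c x0 w0 < 1 ->
  exists S h, [/\ open S, connected S, S `<=` N, S x0 &
    [/\ S `<=` cdom c, solves_on g Pi S h, h x0 = h0 & dscalar h c x0 = w0]].
Proof.
move=> ac Nx0 cx0 w1; pose U := N `&` cdom c.
have oU : open U by exact: dom_open.
have Uc : U `<=` cdom c by move=> y [].
have Ux0 : U x0 by [].
have AC k b i l : Ck c k U (jet_matrix g Pi c b i l) by exact: Ck_jet_matrix.
have flat x b d i l : U x ->
     partial c d (jet_matrix g Pi c b i l) x + \sum_j jet_matrix g Pi c b i j x * jet_matrix g Pi c d j l x =
     partial c b (jet_matrix g Pi c d i l) x + \sum_j jet_matrix g Pi c d i j x * jet_matrix g Pi c b j l x.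
  by move=> [Nx cx]; exact: (jet_matrix_flat g_metric N_open Pi_tensor Pi_sym gauss codazzi).
have [r1 [hr1 /(_ (fun i : @jet_idx n => match i with
    | inl true => h0 | inl false => Num.sqrt (1 - conorm2 g c x0 w0) | inr a => w0 0 a end))
  [Y [Y0 Yc dY]]]] := frobenius_chart oU Uc Ux0 (AC 2%N) flat.
pose h := Y (inl true); pose k := Y (inl false); pose w a := Y (inr a).
pose B1 := chart_ball c x0 r1.
have oB1 : open B1 by exact: chart_ball_open.
have B1c : B1 `<=` cdom c by move=> y [].
have B1x : B1 x0 by exact: chart_ball_center hr1.
have B1U : B1 `<=` U by exact: chart_ball_sub hr1.
have YC m i : Ck c m B1 (Y i).
  by apply: (Ck_bootstrap oB1 B1c _ Yc dY) => m' b i' j; exact: Ck_sub B1U (AC m' b i' j).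
have dh x a : B1 x -> partial c a h x = w a x.
  move=> xb; rewrite (partialE (dY (inl true) a x xb)) sum_jet_idx /= !mul0r !add0r.
  exact: sum_delta.
have dw x a b : B1 x -> is_partial c b (w a) x
    (\sum_d christoffel g c d a b x * w d x + Pi c x a b * k x).
  move=> xb; have := dY (inr a) b x xb; rewrite sum_jet_idx /= mul0r add0r addrC; exact.
have dk x b : B1 x -> is_partial c b k x
    (\sum_d (- \sum_m ginv g c x d m * Pi c x m b) * w d x).
  move=> xb; have := dY (inl false) b x xb; rewrite sum_jet_idx /= !mul0r !add0r; exact.
pose q x := k x * k x + conorm2 g c x (\row_a w a x) - 1.
have qC : Ck c 1 B1 q.
  apply: Ck_add => //; last exact: Ck_cst.
  apply: Ck_add => //; first by apply: Ck_mul => //; exact: YC.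
  apply: (@Ck_ext _ _ _ c 1 B1 (fun x => \sum_i \sum_j ginv g c x i j * w i x * w j x)) => //.
    by move=> x _; apply: eq_bigr => i _; apply: eq_bigr => j _; rewrite !mxE.
  apply: Ck_sum => // i; apply: Ck_sum => // j; apply: Ck_mul => //; last exact: YC.
  apply: Ck_mul => //; last exact: YC.
  exact: Ck_sub B1c (Ck_ginv g_metric 1 i j ac).
have q0 : q x0 = 0.
  rewrite /q /k Y0 -expr2 sqr_sqrtr ?subr_ge0 ?ltW//.
  have -> : \row_a w a x0 = w0 by apply/rowP => a; rewrite mxE /w Y0.
  by ring.
have dq b x : B1 x -> partial c b q x = 0.
  move=> xb; have cx := B1c x xb; apply: partialE.
  have h1 := is_partial_mul cx (dk x b xb) (dk x b xb).
  have h2 := @is_partial_conorm2 _ _ _ g g_metric c b x w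
    (fun a y => Pi c y a b * k y) ac cx (fun a => dw x a b xb).
  have := is_partial_sub (is_partial_add h1 h2) (is_partial_cst c b 1 x).
  apply: is_derive_ext => //; rewrite subr0.
  have -> : \sum_i \sum_j ginv g c x i j * w i x * (Pi c x j b * k x) =
     (\sum_d (\sum_m ginv g c x d m * Pi c x m b) * w d x) * k x.
    rewrite mulr_suml; apply: eq_bigr => i _; rewrite !mulr_suml.
    by apply: eq_bigr => j _; ring.
  under eq_bigr do rewrite mulNr.
  by rewrite sumrN; ring.
have qz x : B1 x -> conorm2 g c x (\row_a w a x) = 1 - k x * k x.
  by move=> xb; have := zero_on_chart_ball cx0 hr1 qC dq q0 xb; rewrite /q => hq; lra.
have k0 : 0 < k x0 by rewrite /k Y0 sqrtr_gt0 subr_gt0.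
have kpos : \forall y \near x0, 0 < k y.
  have kc : k @ x0 --> k x0 by exact: Yc.
  by have /cvgr_gt := kc; apply.
have hall := near_cinv cx0 kpos.
have [r2 r20 hr2] := (near_rowP _ _).1 hall.
pose r := Num.min r1 r2.
have r0 : 0 < r by rewrite lt_min r20; case: hr1 => ->.
have hr : chart_radius c x0 U r by apply: chart_radius_le hr1 r0 _; rewrite ge_min lexx.
pose S := chart_ball c x0 r.
have SB1 : S `<=` B1 by move=> y [cy yr]; split=> //; apply: lt_le_trans yr _; rewrite ge_min lexx.
have kS x : S x -> 0 < k x.
  move=> [cx xr]; have [] := hr2 (cmap c x); last by rewrite cmapK.
  by apply: lt_le_trans xr _; rewrite ge_min lexx orbT.
have dsE x : S x -> dscalar h c x = \row_a w a x.
  by move=> /SB1 xb; apply/rowP => a; rewrite !mxE dh.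
have Sx0 : S x0 by exact: chart_ball_center hr.
exists S, h; split.
- exact: chart_ball_open.
- exact: chart_ball_connected cx0 hr.
- by move=> x /SB1/B1U[].
- exact: Sx0.
split.
- by move=> x [].
- apply: (solves_on_of_chart g_metric Pi_tensor ac).
  + exact: chart_ball_open.
  + by move=> x /SB1/B1U[].
  + by move=> x [].
  + by move=> m; exact: Ck_sub SB1 (YC m (inl true)).
  move=> x Sx; have xb := SB1 x Sx; have kx := kS x Sx.
  rewrite dsE// qz//; split; first by rewrite gtrBl mulr_gt0.
  move=> a b; rewrite subKr -expr2 sqrtr_sqr gtr0_norm//.
  have -> : hessian g h c x a b = Pi c x a b * k x.
    rewrite /hessian.
    have -> : partial c b (partial c a h) x = partial c b (w a) x.
      apply: partial_near; first exact: B1c.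
      by apply: eq_near oB1 xb _ => y yb; rewrite dh.
    rewrite (partialE (dw x a b xb)).
    under [X in _ - X]eq_bigr do rewrite dh//.
    by rewrite addrAC subrr add0r.
  by rewrite mulfK// gt_eqF.
- by rewrite /h Y0.
- by rewrite dsE//; apply/rowP => a; rewrite mxE /w Y0.
Qed.

End Existence.

(** * Gluing and maximality *)

Section Gluing.
Context {R : realType} {n : nat} {M : smooth_manifold R n}.
Variable g : chart R n M -> M -> 'M[R]_n.
Hypothesis g_metric : riemannian_metric g.
Variables (N : set M) (Pi : chart R n M -> M -> 'M[R]_n).
Hypotheses (N_open : open N) (Pi_tensor : tensor2_on N Pi) (Pi_sym : symmetric_on N Pi)
  (gauss : gauss_on g Pi N) (codazzi : codazzi_on g Pi N).
Implicit Types (c : chart R n M) (S U V : set M) (x : M).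

Lemma solves_on_sub S S' h : S' `<=` S -> solves_on g Pi S h -> solves_on g Pi S' h.
Proof.
move=> sub [sh eqs]; split; last by move=> c x ac /sub; exact: eqs.
by move=> c ac k; apply: Ck_sub (sh c ac k) => x [/sub].
Qed.

Lemma solves_on_local S h :
  (forall x, S x -> exists V h', [/\ open V, V x, solves_on g Pi V h' &
     forall y, V y -> h y = h' y]) -> solves_on g Pi S h.
Proof.
move=> loc; split.
  move=> c ac k; apply: Ck_local => x [Sx cx].
  have [V [h' [oV Vx [sh _] hh']]] := loc x Sx.
  have oVc : open (V `&` cdom c) by apply: openI => //; exact: cdom_open.
  exists (V `&` cdom c); split=> //.
  apply: Ck_ext (sh c ac k) => //.
  by move=> y [/hh' ->].
move=> c x ac Sx cx; have [V [h' [oV Vx [sh eqs] hh']]] := loc x Sx.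
have pE y a : V y -> cdom c y -> partial c a h y = partial c a h' y.
  by move=> Vy cy; apply: partial_near => //; exact: eq_near oV Vy hh'.
have dE : dscalar h c x = dscalar h' c x by apply/rowP => a; rewrite !mxE pE.
have [lt1 E] := eqs c x ac Vx cx; rewrite dE; split=> // a b; rewrite E.
suff -> : hessian g h c x a b = hessian g h' c x a b by [].
have E1 : partial c b (partial c a h) x = partial c b (partial c a h') x.
  have oVc : open (V `&` cdom c) by apply: openI => //; exact: cdom_open.
  by apply: partial_near => //; apply: (eq_near oVc) => // y [Vy cy]; rewrite pE.
have E2 : \sum_d christoffel g c d a b x * partial c d h x =
          \sum_d christoffel g c d a b x * partial c d h' x.
  by apply: eq_bigr => d _; rewrite pE.
by rewrite /hessian E1 E2.
Qed.

(** The initial condition on the differential is one between covectors, so it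
    holds in all charts as soon as it holds in one. *)
Lemma initial_at_chart p S h (h0 : R) (w : chart R n M -> 'rV[R]_n) c :
  covector_at p w -> open S -> S p -> solves_on g Pi S h -> atlas c -> cdom c p ->
  h p = h0 -> dscalar h c p = w c -> initial_at p h0 w h.
Proof.
move=> wcov oS Sp [sh _] ac cp hp dp; split=> // c' ac' c'p.
have oU : open (S `&` cdom c) by apply: openI => //; exact: cdom_open.
have Up : (S `&` cdom c) p by [].
have Uc : S `&` cdom c `<=` cdom c by move=> y [].
by rewrite (dscalar_change ac' ac oU Uc (sh c ac 1%N) Up c'p) dp -wcov.
Qed.

Lemma initial_unique p S S' h h' h0 w : connected S -> open S -> S `<=` N -> S p ->
  S `<=` S' -> solves_on g Pi S h -> solves_on g Pi S' h' ->
  initial_at p h0 w h -> initial_at p h0 w h' -> forall x, S x -> h x = h' x.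
Proof.
move=> cS oS SN Sp SS' sh sh' [hp dp] [hp' dp'].
have hpp : h p = h' p by rewrite hp.
have dpp c : atlas c -> cdom c p -> dscalar h c p = dscalar h' c p.
  by move=> ac cp; rewrite dp// dp'.
exact: (solution_unique g_metric N_open Pi_tensor cS oS SN Sp sh
  (solves_on_sub SS' sh') hpp dpp).
Qed.

(** Of two members of the chain one contains the other, and their solutions
    agree on the smaller one by [initial_unique].  All nonempty members
    contain [p], so that their union is connected. *)
Lemma admissible_chain p h0 w (F : set (set M)) S0 :
  (forall S, F S -> S = set0 \/ admissible g Pi N p h0 w S) -> total_on F subset ->
  F S0 -> admissible g Pi N p h0 w S0 ->
  admissible g Pi N p h0 w (\bigcup_(S in F) S).
Proof.
move=> FP tot FS0 adm0; pose X := \bigcup_(S in F) S.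
have FA S x : F S -> S x -> admissible g Pi N p h0 w S.
  by move=> FS Sx; have [S0E|//] := FP S FS; rewrite S0E in Sx.
have /choice[H HS] : forall S, exists h : M -> R, admissible g Pi N p h0 w S ->
    solves_on g Pi S h /\ initial_at p h0 w h.
  move=> S; have [[_ _ _ _ [h hS]]|nS] := pselect (admissible g Pi N p h0 w S).
    by exists h.
  by exists (fun=> 0) => /nS.
have /choice[T TX] : forall x, exists S, X x -> F S /\ S x.
  move=> x; have [[S FS Sx]|nX] := pselect (X x); first by exists S.
  by exists set0 => /nX.
pose h x := H (T x) x.
have agree S S' x : F S -> F S' -> S x -> S' x -> H S x = H S' x.
  move=> FS FS' Sx S'x.
  have aS := FA S x FS Sx; have aS' := FA S' x FS' S'x.
  have [sS iS] := HS S aS; have [sS' iS'] := HS S' aS'.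
  have [oS cS SN Sp _] := aS; have [oS' cS' S'N S'p _] := aS'.
  have [SS'|S'S] := tot S S' FS FS'.
    exact: (initial_unique cS oS SN Sp SS' sS sS' iS iS').
  by apply/esym; exact: (initial_unique cS' oS' S'N S'p S'S sS' sS iS' iS).
have hE S x : F S -> S x -> h x = H S x.
  move=> FS Sx; have [FT Tx] := TX x (ex_intro2 _ _ S FS Sx); exact: agree.
have [oS0 cS0 S0N S0p _] := adm0.
have sX : solves_on g Pi X h.
  apply: solves_on_local => x [S FS Sx]; have aS := FA S x FS Sx.
  have [oS _ _ _ _] := aS; have [sS _] := HS S aS.
  by exists S, (H S); split=> // y Sy; exact: hE.
have oX : open X by apply: bigcup_open => S FS; have [->|[]//] := FP S FS; exact: open0.
have Xp : X p by exists S0.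
split=> //.
- have XE : X = \bigcup_(S in F `&` [set S | S p]) S.
    apply/seteqP; split=> [x [S FS Sx]|x [S [FS _] Sx]]; exists S => //.
    by split=> //; have [] := FA S x FS Sx.
  change (connected X); rewrite XE.
  apply: bigcup_connected; first by exists p => S [].
  by move=> S [FS Sp]; have [] := FA S p FS Sp.
- by move=> x [S FS Sx]; have [_ _ SN _ _] := FA S x FS Sx; exact: SN.
exists h; split=> //; have [sS0 [hp dp]] := HS S0 adm0.
have hS0 y : S0 y -> h y = H S0 y by exact: hE.
split; first by rewrite hS0.
move=> c ac cp; rewrite -dp//; apply/rowP => a; rewrite !mxE.
by apply: partial_near => //; exact: eq_near oS0 S0p hS0.
Qed.

(** The empty set is added to the family because the union of the empty chain
    must belong to it; a maximal element is nonempty since [S0] is. *)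
Lemma maximal_admissible p h0 w S0 : admissible g Pi N p h0 w S0 ->
  exists S, maximal_set (admissible g Pi N p h0 w) S.
Proof.
move=> adm0.
pose P S := S = set0 \/ admissible g Pi N p h0 w S.
have [|A [PA maxA]] := @Zorn_bigcup M P.
  move=> F FP tot; have [[S FS aS]|none] := pselect (exists2 S, F S & admissible g Pi N p h0 w S).
    by right; exact: admissible_chain tot FS aS.
  left; apply/seteqP; split=> // x [S FS Sx].
  have [SE|aS] := FP S FS; first by rewrite SE in Sx.
  by case: none; exists S.
have aA : admissible g Pi N p h0 w A.
  case: PA => // A0; case: (maxA S0); last by right.
  have [_ _ _ S0p _] := adm0.
  by rewrite A0; split=> // /(_ p S0p).
exists A; split=> // S' aS' AS'; apply/seteqP; split=> //.
by have [//|nS] := pselect (S' `<=` A); case: (maxA S'); [split|right].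
Qed.

End Gluing.

Theorem lemma3p3 (R : realType) (n : nat) (M : smooth_manifold R n)
  (g : chart R n M -> M -> 'M[R]_n) (g_metric : riemannian_metric g)
  (N : set M) (N_open : open N) (N_contractible : contractible R N)
  (Pi : chart R n M -> M -> 'M[R]_n)
  (Pi_tensor : tensor2_on N Pi) (Pi_sym : symmetric_on N Pi)
  (gauss : gauss_on g Pi N) (codazzi : codazzi_on g Pi N)
  (p : M) (Np : N p)
  (h0 : R) (w : chart R n M -> 'rV[R]_n) (w_covector : covector_at p w)
  (w_small : forall c, atlas c -> cdom c p -> conorm2 g c p (w c) < 1) :
  exists S : set M,
    maximal_set (admissible g Pi N p h0 w) S /\
    exists h : M -> R,
      [/\ solves_on g Pi S h, initial_at p h0 w h &
        forall h' : M -> R, solves_on g Pi S h' -> initial_at p h0 w h' ->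
          forall x, S x -> h' x = h x].
Proof.
have [c ac cp] := atlas_cover p.
have [S0 [h1 [oS0 cS0 S0N S0p [_ sh1 h1p d1p]]]] :=
  local_solution g_metric N_open Pi_tensor Pi_sym gauss codazzi h0 ac Np cp (w_small c ac cp).
have adm0 : admissible g Pi N p h0 w S0.
  split=> //; exists h1; split=> //.
  exact: (initial_at_chart w_covector oS0 S0p sh1 ac cp h1p d1p).
have [S maxS] := maximal_admissible g_metric N_open Pi_tensor adm0.
exists S; split=> //; have [[oS cS SN Sp [h [sh ih]]] _] := maxS.
exists h; split=> // h' sh' ih'.
exact: (initial_unique g_metric N_open Pi_tensor cS oS SN Sp (fun x => id) sh' sh ih' ih).
Qed.
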